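(* Let $k\geq1$, $n_i\geq1$, $d_i\geq0$ $(1\leq i\leq k)$ be integers, and let $a_{i,j}\in\mathbb Q_p$ $(0\leq j\leq d_i)$ satisfy $a_{i,d_i}\neq0$ for each $i$. Put $\Lambda=\sum_{i=1}^kn_i\max\{1,d_i\}$, $\mathcal V=\prod_{i=1}^k(\mathbb Q_p^{n_i})^{d_i+1}$ and, for $r\in\mathbb Q_p$ and $v=(v_{i,j})\in\mathcal V$, $$\widetilde P_r(v)=\Bigl(\sum_{j=0}^{d_i}a_{i,j}r^jv_{i,j}\Bigr)_{i=1}^k\in\prod_{i=1}^k\mathbb Q_p^{n_i}.$$ Fix $\boldsymbol\alpha=(\alpha_1,\ldots,\alpha_k)\in[0,\infty)^k$, and let $\mathcal E\subset\mathcal V$ be a nonempty set whose absorbed coefficient set $\mathcal A=\{(a_{i,j}v_{i,j})_{1\le i\le k,\,0\le j\le d_i}:v\in\mathcal E\}$ is bounded. For a compact ball $B\subset\mathbb Q_p$ of positive radius put $$M_{\delta,B}=\max_{s\in B}N_\delta^{\boldsymbol\alpha}(\widetilde P_s(\mathcal E)).$$ This maximum exists and is finite. There is a constant $C$ such that, for every integer $\ell\geq1$, $\delta=p^{-\ell}$, and $0<\eta<1$, $$\mu_B\bigl\{r\in B:N_\delta^{\boldsymbol\alpha}(\widetilde P_r(\mathcal E))<\eta M_{\delta,B}\bigr\}\leq C(1+\ell)^{(\Lambda+1)/\Lambda}\eta^{1/\Lambda}.$$ In particular, the same bound holds with $M_{\delta,B}$ replaced by $N_\delta^{\boldsymbol\alpha}(\widetilde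 P_{r_0}(\mathcal E))$, uniformly for all $r_0\in B$. The constant $C$ depends only on $p,(n_i),(d_i),\boldsymbol\alpha,B$ and a fixed bound for $\mathcal A$ (i.e. a number $R$ with $\|b\|\leq R$ for all $b\in\mathcal A$), and not on $\ell,\eta,r_0$, or the particular coefficient set within that bound.
   Context: $p$ is a fixed prime, $|p|_p=p^{-1}$, and Cartesian powers of $\mathbb Q_p$ carry the supremum norm and metric. $\mathcal L^1$ is Haar measure on $\mathbb Q_p$ with $\mathcal L^1(\mathbb Z_p)=1$, and $\mu_B(A)=\mathcal L^1(A\cap B)/\mathcal L^1(B)$ is normalized Haar measure on $B$. For $\boldsymbol\alpha\in[0,\infty)^k$ and $0<\delta<1$ put $m_i(\delta)=\lceil\alpha_i\log_p(1/\delta)\rceil$ and $\mathcal Q_\delta^{\boldsymbol\alpha}=\prod_{i=1}^kp^{m_i(\delta)}\mathbb Z_p^{n_i}$. For $A\subset\prod_i\mathbb Q_p^{n_i}$, $N_\delta^{\boldsymbol\alpha}(A)$ is the number of cosets of $\mathcal Q_\delta^{\boldsymbol\alpha}$ that meet $A$ (equivalently, the least number of such translates covering $A$). No measurability of $\mathcal E$ is assumed. *)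

(* Defs.v *)
From HB Require Import structures.
From mathcomp Require Import all_boot all_order all_algebra.
From mathcomp Require Import all_classical all_reals all_analysis.
From mathcomp Require Import zify ring.

Set Implicit Arguments.
Unset Strict Implicit.
Unset Printing Implicit Defensive.

Import Order.TTheory GRing.Theory Num.Theory.
Import numFieldNormedType.Exports.

Local Open Scope classical_set_scope.
Local Open Scope ring_scope.

Section PadicAbs.
Variable p : nat.

(* The p-adic absolute value on rat: |a / b| = p ^ (v_p b - v_p a). *)
Definition padic_abs (x : rat) : rat :=
  if x == 0 then 0
  else p%:R ^ ((logn p `|denq x|)%:Z - (logn p `|numq x|)%:Z).

Context (p_pr : prime p).

Let v (a : int) : int := (logn p `|a|)%:Z.

Let p_gt0 : 0 < p%:R :> rat.
Proof. by rewrite ltr0n prime_gt0. Qed.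

Let p_neq0 : p%:R != 0 :> rat.
Proof. exact: lt0r_neq0. Qed.

Let p_ge1 : 1 <= p%:R :> rat.
Proof. by rewrite ler1n prime_gt0. Qed.

Let vM (a b : int) : a != 0 -> b != 0 -> v (a * b) = v a + v b.
Proof. by move=> a0 b0; rewrite /v abszM lognM ?absz_gt0// PoszD. Qed.

Let vD (a b : int) : a + b != 0 -> a != 0 -> b != 0 ->
  Num.min (v a) (v b) <= v (a + b).
Proof.
move=> ab0 a0 b0; set m := minn (logn p `|a|) (logn p `|b|).
have -> : Num.min (v a) (v b) = m%:Z.
  rewrite /m /v; have [h|h] := leqP (logn p `|a|) (logn p `|b|).
    by rewrite min_l.
  by rewrite min_r// lez_nat ltnW.
rewrite /v lez_nat -pfactor_dvdn ?absz_gt0//.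
have : (((p ^ m)%N%:Z %| a + b)%Z).
  have mdv c : c != 0 -> (m <= logn p `|c|)%N -> ((p ^ m)%N%:Z %| c)%Z.
    by move=> c0 mc; rewrite dvdzE pfactor_dvdn ?absz_gt0.
  by apply: rpredD; apply: mdv; rewrite // /m ?geq_minl ?geq_minr.
by rewrite dvdzE.
Qed.

Let abs_frac (a b : int) : a != 0 -> b != 0 ->
  padic_abs (a%:~R / b%:~R) = p%:R ^ (v b - v a).
Proof.
move=> a0 b0; set x := _ / _.
have a0' : a%:~R != 0 :> rat by rewrite intr_eq0.
have b0' : b%:~R != 0 :> rat by rewrite intr_eq0.
have x0 : x != 0 by rewrite mulf_neq0 ?invr_eq0.
have nx0 : numq x != 0 by rewrite numq_eq0.
have dx0 : denq x != 0 by rewrite denq_eq0.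
have dx0' : (denq x)%:~R != 0 :> rat by rewrite intr_eq0.
rewrite /padic_abs (negbTE x0); congr (_ ^ _).
have E : numq x * b = a * denq x.
  apply/eqP; rewrite -(eqr_int rat) !intrM; apply/eqP.
  have := divq_num_den x; rewrite {3}/x => /(canRL (divfK dx0')) ->.
  by rewrite mulrAC divfK.
have : v (numq x * b) = v (a * denq x) by rewrite E.
rewrite !vM// /v => /eqP; rewrite -subr_eq => /eqP H.
by apply/eqP; rewrite subr_eq; apply/eqP; move: H; lia.
Qed.

Lemma padic_abs0 : padic_abs 0 = 0.
Proof. by rewrite /padic_abs eqxx. Qed.

Lemma padic_abs_ge0 x : 0 <= padic_abs x.
Proof. by rewrite /padic_abs; case: ifP => // _; rewrite exprz_ge0// ltW. Qed.

Lemma padic_abs_eq0 x : (padic_abs x == 0) = (x == 0).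
Proof.
rewrite /padic_abs; case: ifP => [_|_]; first by rewrite eqxx.
by rewrite expfz_eq0 (negbTE p_neq0) andbF.
Qed.

Lemma padic_absM x y : padic_abs (x * y) = padic_abs x * padic_abs y.
Proof.
have [->|x0] := eqVneq x 0; first by rewrite mul0r padic_abs0 mul0r.
have [->|y0] := eqVneq y 0; first by rewrite mulr0 padic_abs0 mulr0.
rewrite -{1}(divq_num_den x) -{1}(divq_num_den y) mulf_div -!intrM.
rewrite abs_frac ?mulf_neq0 ?numq_eq0 ?denq_eq0//.
rewrite !vM ?numq_eq0 ?denq_eq0// /padic_abs (negbTE x0) (negbTE y0).
by rewrite -expfzDr//; congr (_ ^ _); rewrite /v opprD addrACA.
Qed.

Lemma padic_absD x y :
  padic_abs (x + y) <= Num.max (padic_abs x) (padic_abs y).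
Proof.
have [->|x0] := eqVneq x 0; first by rewrite add0r le_max lexx orbT.
have [->|y0] := eqVneq y 0; first by rewrite addr0 le_max lexx.
have [->|s0] := eqVneq (x + y) 0; first by rewrite padic_abs0 le_max padic_abs_ge0.
have nx := x0; have ny := y0; rewrite -numq_eq0 in nx; rewrite -numq_eq0 in ny.
have dx : denq x != 0 by rewrite denq_eq0.
have dy : denq y != 0 by rewrite denq_eq0.
have E : x + y =
    (numq x * denq y + numq y * denq x)%:~R / (denq x * denq y)%:~R.
  rewrite -{1}(divq_num_den x) -{1}(divq_num_den y) addf_div ?intr_eq0//.
  by rewrite intrD !intrM.
have n0 : numq x * denq y + numq y * denq x != 0.
  by apply: contra s0 => /eqP h; rewrite E h mul0r.
have nd0 := mulf_neq0 nx dy; have nd0' := mulf_neq0 ny dx.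
have := vD n0 nd0 nd0'.
rewrite {1}E abs_frac ?mulf_neq0//.
have absE z : z != 0 -> padic_abs z = p%:R ^ (v (denq z) - v (numq z)).
  by move=> z0; rewrite /padic_abs (negbTE z0).
rewrite (absE x)// (absE y)// !vM//.
have key (a b c s : int) : c + b <= s -> a + b - s <= a - c by lia.
rewrite le_max ge_min; case/orP => h; apply/orP; [left|right];
  apply: ler_weXz2l => //; first exact: key.
by rewrite [v (denq x) + _]addrC; exact: key.
Qed.

Lemma padic_absN x : padic_abs (- x) = padic_abs x.
Proof.
by rewrite /padic_abs oppr_eq0 denqN numqN abszN.
Qed.

Lemma padic_abs1 : padic_abs 1 = 1.
Proof. by rewrite /padic_abs /= subrr expr0z. Qed.

End PadicAbs.

Section PadicField.
Variables (p : nat) (p_pr : prime p).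

Local Notation "|[ x ]|" := (padic_abs p x) (format "|[ x ]|").

Definition padic_cauchy (u : nat -> rat) : Prop :=
  forall e : rat, 0 < e -> exists N : nat, forall m n : nat,
    (N <= m)%N -> (N <= n)%N -> |[u m - u n]| < e.

Definition padic_null (u : nat -> rat) : Prop :=
  forall e : rat, 0 < e -> exists N : nat, forall n : nat,
    (N <= n)%N -> |[u n]| < e.

Let abs_ge0 x : 0 <= |[x]| := padic_abs_ge0 p x.
Let absM := padic_absM p_pr.
Let absD := padic_absD p_pr.

Let absB_lt x y e : |[x]| < e -> |[y]| < e -> |[x - y]| < e.
Proof.
move=> xe ye; apply: le_lt_trans (absD _ _) _.
by rewrite padic_absN gt_max xe.
Qed.

Let absD_lt x y e : |[x]| < e -> |[y]| < e -> |[x + y]| < e.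
Proof. by move=> xe ye; apply: le_lt_trans (absD _ _) _; rewrite gt_max xe. Qed.

Let cauchy_bounded u : padic_cauchy u ->
  exists2 M : rat, 0 < M & exists N : nat, forall n, (N <= n)%N -> |[u n]| < M.
Proof.
move=> /(_ 1 ltr01)[N HN]; exists (|[u N]| + 1).
  by rewrite ltr_wpDl.
exists N => n Nn; rewrite -(subrK (u N) (u n)); apply: absD_lt.
  by apply: lt_le_trans (HN _ _ Nn (leqnn _)) _; rewrite lerDr.
by rewrite ltrDl.
Qed.

Let cauchy_sub u w : padic_cauchy u -> padic_cauchy w -> padic_cauchy (u - w).
Proof.
move=> cu cw e e0; have [N HN] := cu e e0; have [N' HN'] := cw e e0.
exists (maxn N N') => m n; rewrite !geq_max => /andP[m1 m2] /andP[n1 n2].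
have -> : (u - w) m - (u - w) n = (u m - u n) - (w m - w n).
  by rewrite -[LHS]/((u m - w m) - (u n - w n)); ring.
by apply: absB_lt; [apply: HN|apply: HN'].
Qed.

Let cauchy_mul u w : padic_cauchy u -> padic_cauchy w -> padic_cauchy (u * w).
Proof.
move=> cu cw e e0.
have [M M0 [N1 H1]] := cauchy_bounded cu.
have [M' M'0 [N2 H2]] := cauchy_bounded cw.
have [N3 H3] := cu (e / M') (divr_gt0 e0 M'0).
have [N4 H4] := cw (e / M) (divr_gt0 e0 M0).
exists (maxn (maxn N1 N2) (maxn N3 N4)) => m n.
rewrite !geq_max => /andP[/andP[m1 m2] /andP[m3 m4]].
move=> /andP[/andP[n1 n2] /andP[n3 n4]].
have -> : (u * w) m - (u * w) n = u m * (w m - w n) + (u m - u n) * w n.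
  by rewrite -[LHS]/(u m * w m - u n * w n); ring.
apply: absD_lt; rewrite absM.
  apply: le_lt_trans (ler_wpM2r (abs_ge0 _) (ltW (H1 _ m1))) _.
  by rewrite mulrC -ltr_pdivlMr// H4.
apply: le_lt_trans (ler_wpM2l (abs_ge0 _) (ltW (H2 _ n2))) _.
by rewrite -ltr_pdivlMr// H3.
Qed.

Lemma padic_cauchy_cst c : padic_cauchy (fun=> c).
Proof. by move=> e e0; exists 0%N => *; rewrite subrr padic_abs0. Qed.

Definition padic_cauchy_pred of prime p : {pred (nat -> rat)} :=
  fun u => `[< padic_cauchy u >].

Let cauchy_predE u : (u \in padic_cauchy_pred p_pr) = `[< padic_cauchy u >].
Proof. by []. Qed.

Let cauchy_subring : subring_closed (padic_cauchy_pred p_pr).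
Proof.
split; first by rewrite cauchy_predE; apply/asboolP; exact: padic_cauchy_cst.
- move=> u w; rewrite !cauchy_predE => /asboolP cu /asboolP cw.
  by apply/asboolP; exact: cauchy_sub.
- move=> u w; rewrite !cauchy_predE => /asboolP cu /asboolP cw.
  by apply/asboolP; exact: cauchy_mul.
Qed.

HB.instance Definition _ := GRing.isSubringClosed.Build (nat -> rat)
  (padic_cauchy_pred p_pr) cauchy_subring.

Record padic_seq := PadicSeq {
  padic_seq_val :> nat -> rat ;
  _ : padic_seq_val \in padic_cauchy_pred p_pr }.

HB.instance Definition _ := [isSub for padic_seq_val].
HB.instance Definition _ := [Choice of padic_seq by <:].
HB.instance Definition _ :=
  [SubChoice_isSubComNzRing of padic_seq by <:].

Lemma padic_seqP (u : padic_seq) : padic_cauchy u.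
Proof. by case: u => u /= /asboolP. Qed.

Definition padic_null_pred : {pred padic_seq} :=
  fun u => `[< padic_null u >].

Let null_predE u : (u \in padic_null_pred) = `[< padic_null u >].
Proof. by []. Qed.

Let null_ideal : idealr_closed padic_null_pred.
Proof.
split; rewrite ?null_predE.
- by apply/asboolP => e e0; exists 0%N => n _; rewrite padic_abs0.
- apply/asboolP => /(_ 1 ltr01)[N /(_ N (leqnn N))].
  by rewrite padic_abs1 ltxx.
- move=> a u w; rewrite !null_predE => /asboolP nu /asboolP nw.
  apply/asboolP => e e0.
  have [M M0 [N1 H1]] := cauchy_bounded (padic_seqP a).
  have [N2 H2] := nu (e / M) (divr_gt0 e0 M0).
  have [N3 H3] := nw e e0.
  exists (maxn N1 (maxn N2 N3)) => n; rewrite !geq_max => /and3P[n1 n2 n3].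
  rewrite -[padic_seq_val _ _]/(a n * u n + w n).
  apply: absD_lt (H3 _ n3); rewrite absM.
  apply: le_lt_trans (ler_wpM2r (abs_ge0 _) (ltW (H1 _ n1))) _.
  by rewrite mulrC -ltr_pdivlMr// H2.
Qed.

HB.instance Definition _ := isIdealr.Build padic_seq padic_null_pred null_ideal.

(* Q_p is constructed as the completion of rat for padic_abs: the ring of
   Cauchy sequences modulo the ideal of null sequences. *)
Definition padic := {ideal_quot padic_null_pred}.

HB.instance Definition _ := GRing.ComNzRing.on padic.

Lemma padic_cauchy_away u : padic_cauchy u -> ~ padic_null u ->
  exists2 c : rat, 0 < c & exists N : nat, forall n, (N <= n)%N -> c <= |[u n]|.
Proof.
move=> cu nu; have [e [e0 He]] : exists e : rat, 0 < e /\
    forall N, exists2 n, (N <= n)%N & e <= |[u n]|.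
  apply: contrapT => H; apply: nu => e e0; apply: contrapT => H'; apply: H.
  exists e; split=> // N; apply: contrapT => H; apply: H'; exists N => n Nn.
  by rewrite ltNge; apply/negP => h; apply: H; exists n.
exists e => //; have [N HN] := cu e e0; exists N => n Nn.
have [n1 Nn1 h] := He N; rewrite leNgt; apply/negP => h'.
move: h; rewrite leNgt => /negP; apply.
by rewrite -(subrK (u n) (u n1)); apply: absD_lt => //; exact: HN.
Qed.

Local Notation pi := (\pi_{ideal_quot padic_null_pred})%qT.

Let pi_eq0 (u : padic_seq) : (pi u == 0) = `[< padic_null u >].
Proof. by rewrite -(rmorph0 pi) -Quotient.idealrBE subr0. Qed.

Let padic_inv_exists (x : padic) : x != 0 -> exists y, y * x = 1.
Proof.
rewrite -[x]reprK; set u := repr x; rewrite pi_eq0 => /asboolP nu.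
have cu := padic_seqP u.
have [c c0 [N HN]] := padic_cauchy_away cu nu.
have un0 n : (N <= n)%N -> u n != 0.
  by move=> /HN; apply: contraTneq => ->; rewrite padic_abs0 -ltNge.
have cw : (fun n => (u n)^-1) \in padic_cauchy_pred p_pr.
  rewrite cauchy_predE; apply/asboolP => e e0.
  have [N' HN'] := cu (e * (c * c)) (mulr_gt0 e0 (mulr_gt0 c0 c0)).
  exists (maxn N N') => m n; rewrite !geq_max => /andP[m1 m2] /andP[n1 n2].
  have um := un0 _ m1; have un := un0 _ n1.
  have := HN' _ _ n2 m2.
  have -> : u n - u m = ((u m)^-1 - (u n)^-1) * (u m * u n) by field; apply/andP.
  rewrite !absM; apply: contraTT; rewrite -!leNgt => h.
  have ccm : c * c <= |[u m]| * |[u n]| by apply: ler_pM; rewrite ?HN// ltW.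
  by apply: ler_pM => //; rewrite ltW ?mulr_gt0.
exists (pi (PadicSeq cw)); apply/eqP.
rewrite -subr_eq0 -rmorphM -(rmorph1 pi) -rmorphB pi_eq0; apply/asboolP => e e0.
exists N => n Nn.
by rewrite -[padic_seq_val _ _]/((u n)^-1 * u n - 1) mulVf ?un0// subrr.
Qed.

(* xget returns the default 0 when no inverse exists, i.e. for x = 0. *)
Definition padic_inv (x : padic) : padic := xget 0 [set y : padic | y * x = 1].

Let padic_mulVf x : x != 0 -> padic_inv x * x = 1.
Proof.
by move=> /padic_inv_exists[y yx]; rewrite /padic_inv; case: xgetP => // /(_ y).
Qed.

Let padic_inv0 : padic_inv 0 = 0.
Proof.
rewrite /padic_inv; case: xgetP => // y _ /=.
by rewrite mulr0 => /esym/eqP; rewrite oner_eq0.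
Qed.

HB.instance Definition _ :=
  GRing.ComNzRing_isField.Build padic padic_mulVf padic_inv0.
HB.instance Definition _ := isPointed.Build padic 0.

End PadicField.

Section PadicNorm.
Variables (R : realType) (p : nat) (p_pr : prime p).
Local Notation Qp := (padic p_pr).

(* [repr x] is an arbitrary representing Cauchy sequence; padic_norm_pi shows
   that the limit exists and does not depend on it. *)
Definition padic_norm (x : Qp) : R :=
  lim ((ratr (padic_abs p (repr x n)) : R) @[n --> \oo]).

End PadicNorm.

Section PadicNormTheory.
Variables (R : realType) (p : nat) (p_pr : prime p).
Local Notation Qp := (padic p_pr).
Local Notation pi := (\pi_{ideal_quot (@padic_null_pred p p_pr)})%qT.
Local Notation "|[ x ]|" := (padic_abs p x) (format "|[ x ]|").

Let abs_close x y : |[x - y]| < |[y]| -> |[x]| = |[y]|.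
Proof.
move=> h; apply/eqP; rewrite eq_le; apply/andP; split.
  rewrite -{1}(subrK y x); apply: le_trans (padic_absD p_pr _ _) _.
  by rewrite ge_max lexx ltW.
rewrite leNgt; apply/negP => h'; have : |[y]| < |[y]|.
  rewrite -{1}(subKr x y); apply: le_lt_trans (padic_absD p_pr _ _) _.
  by rewrite padic_absN gt_max h'.
by rewrite ltxx.
Qed.

Let absB_null u w : padic_null p (u - w) -> padic_cauchy p w ->
  padic_null p w \/
  exists N, forall n, (N <= n)%N -> |[u n]| = |[w n]| /\ |[w n]| = |[w N]|.
Proof.
move=> nuw cw; have [nw|nw] := pselect (padic_null p w); [by left|right].
have [c c0 [N HN]] := padic_cauchy_away p_pr cw nw.
have [N1 H1] := nuw c c0; have [N2 H2] := cw c c0.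
exists (maxn N (maxn N1 N2)) => n; rewrite !geq_max => /and3P[n0 n1 n2].
split; apply: abs_close.
  by apply: lt_le_trans (HN _ n0); exact: H1.
apply: lt_le_trans (HN _ _); rewrite ?H2 ?leq_maxl//.
by rewrite !leq_max leqnn !orbT.
Qed.

Let null_cvg (w : nat -> rat) : padic_null p w ->
  (ratr |[w n]| : R) @[n --> \oo] --> (0 : R).
Proof.
move=> nw; apply/cvgrPdist_lt => e e0.
have [q] := rat_in_itvoo e0; rewrite inE/=; move=> /itvP qe.
have q0 : 0 < q by rewrite -(ltr0q R) qe.
have [N HN] := nw q q0; exists N => // n /= Nn.
rewrite sub0r normrN ger0_norm ?ler0q ?padic_abs_ge0//.
by apply: lt_trans (_ : ratr q < e); rewrite ?qe// ltr_rat HN.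
Qed.

Let nullP (u : padic_seq p_pr) :
  (u \in @padic_null_pred p p_pr) = `[< padic_null p u >].
Proof. by []. Qed.

Lemma padic_norm_pi (u : padic_seq p_pr) :
  (ratr |[u n]| : R) @[n --> \oo] --> padic_norm R (pi u).
Proof.
rewrite /padic_norm; set w := repr (pi u).
have nuw : padic_null p (u - w).
  by apply/asboolP; rewrite -nullP Quotient.idealrBE reprK.
have [nw | [N HN] ] := absB_null nuw (padic_seqP w).
  rewrite (cvg_lim _ (null_cvg nw))//; apply: null_cvg => e e0.
  have [N1 H1] := nuw e e0; have [N2 H2] := nw e e0.
  exists (maxn N1 N2) => n; rewrite geq_max => /andP[n1 n2].
  rewrite -(subrK (w n) (u n)); apply: le_lt_trans (padic_absD p_pr _ _) _.
  by rewrite gt_max H2// andbT; exact: H1.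
have cw : (ratr |[w n]| : R) @[n --> \oo] --> (ratr |[w N]| : R).
  by apply: cvg_near_cst; exists N => // n /= /HN[_ ->].
rewrite (cvg_lim _ cw)//.
by apply: cvg_near_cst; exists N => // n /= /HN[-> ->].
Qed.

Lemma padic_norm_eq0 (x : Qp) : (padic_norm R x == 0) = (x == 0).
Proof.
rewrite -[x]reprK; set u := repr x.
rewrite -[RHS](_ : (u \in @padic_null_pred p p_pr) = _); last first.
  by rewrite -(rmorph0 pi) -Quotient.idealrBE subr0.
rewrite nullP; apply/eqP/asboolP => [n0|nu]; last first.
  by apply: (cvg_unique _ (@padic_norm_pi u) (null_cvg nu)).
apply: contrapT => nu.
have [c c0 [N HN]] := padic_cauchy_away p_pr (padic_seqP u) nu.
have := @padic_norm_pi u; rewrite n0 => h.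
have : (ratr c : R) <= 0.
  apply: (cvgr_to_ge h); exists N => // n /= Nn.
  by rewrite ler_rat HN.
by rewrite leNgt ltr0q c0.
Qed.

Lemma padic_normM (x y : Qp) :
  padic_norm R (x * y) = padic_norm R x * padic_norm R y.
Proof.
rewrite -[x]reprK -[y]reprK -rmorphM.
apply: (cvg_unique _ (@padic_norm_pi _)) => //.
rewrite (_ : (fun n => _) = fun n => (ratr |[repr x n]| : R) * ratr |[repr y n]|).
  by apply: cvgM; exact: padic_norm_pi.
by apply/funext => n; rewrite -rmorphM -padic_absM.
Qed.

Lemma padic_normD (x y : Qp) :
  padic_norm R (x + y) <= Num.max (padic_norm R x) (padic_norm R y).
Proof.
rewrite -[x]reprK -[y]reprK -rmorphD.
set u := repr x; set w := repr y.
set m := Num.max _ _; apply/ler_addgt0Pr => e e0.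
have mx : padic_norm R (pi u) < m + e.
  by rewrite ltr_pwDr// /m le_max lexx.
have my : padic_norm R (pi w) < m + e.
  by rewrite ltr_pwDr// /m le_max lexx orbT.
apply: (cvgr_to_le (@padic_norm_pi _)).
have [N1 _ H1] := cvgr_lt _ (@padic_norm_pi u) _ mx.
have [N2 _ H2] := cvgr_lt _ (@padic_norm_pi w) _ my.
exists (maxn N1 N2) => // n /=; rewrite geq_max => /andP[n1 n2].
have := padic_absD p_pr (u n) (w n); rewrite -(ler_rat R) => /le_trans; apply.
by case: (leP |[u n]| |[w n]|) => _; apply: ltW; [exact: H2|exact: H1].
Qed.

Let cst_seq (q : rat) : padic_seq p_pr := PadicSeq
  (introT (asboolP (padic_cauchy p (fun=> q))) (padic_cauchy_cst p q)).

Let rat_pi q : (pi (cst_seq q) : Qp) = ratr q.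
Proof.
pose g : rat -> Qp := fun a => pi (cst_seq a).
have addB : zmod_morphism g.
  by move=> a b; rewrite -[RHS](rmorphB pi); congr (pi _); apply: val_inj.
have mulM : monoid_morphism g.
  split=> [|a b]; first by rewrite -[RHS](rmorph1 pi); congr (pi _); apply: val_inj.
  by rewrite -[RHS](rmorphM pi); congr (pi _); apply: val_inj.
pose f : {rmorphism rat -> Qp} := HB.pack g
  (GRing.isZmodMorphism.Build _ _ _ addB) (GRing.isMonoidMorphism.Build _ _ _ mulM).
exact: (fmorph_eq_rat f).
Qed.

Lemma padic_norm_ratr (q : rat) : padic_norm R (ratr q : Qp) = ratr |[q]|.
Proof.
have h : (ratr |[cst_seq q n]| : R) @[n --> \oo] --> (ratr |[q]| : R).
  by apply: cvg_near_cst; exists 0%N.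
by rewrite -rat_pi; apply: (cvg_unique _ (@padic_norm_pi (cst_seq q)) h).
Qed.

Lemma padic_dense (x : Qp) (e : R) : 0 < e ->
  exists q : rat, padic_norm R (x - ratr q) < e.
Proof.
move=> e0; have [e'] := rat_in_itvoo e0; rewrite inE/=; move=> /itvP he.
have e'0 : 0 < e' by rewrite -(ltr0q R) he.
rewrite -[x]reprK; set u := repr x.
have [N HN] := padic_seqP u e'0; exists (u N).
rewrite -rat_pi -rmorphB; apply: le_lt_trans (_ : ratr e' < e); last by rewrite he.
apply: (cvgr_to_le (@padic_norm_pi _)); exists N => // n /= Nn.
by rewrite ler_rat ltW// HN.
Qed.
End PadicNormTheory.

Section Haar.
Variables (R : realType) (p : nat) (p_pr : prime p).
Local Notation Qp := (padic p_pr).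

Definition padic_int : set Qp := [set x | padic_norm R x <= 1].

(* In Q_p every ball of positive radius, open or closed, is compact and is a
   closed ball of positive radius, so these are all the compact balls. *)
Definition padic_ball (c : Qp) (rho : R) : set Qp :=
  [set x | padic_norm R (x - c) <= rho].

Definition padic_open : set (set Qp) :=
  [set U | forall x, U x ->
     exists2 e : R, 0 < e & forall y, padic_norm R (y - x) < e -> U y].

(* The Borel sigma-algebra, generated by the open sets of the metric. *)
Definition padic_borel := g_sigma_algebraType padic_open.

(* Haar measure is the unique translation-invariant Borel measure giving Z_p
   mass 1 (local finiteness follows from the normalization). *)
Definition is_haar (mu : {measure set padic_borel -> \bar R}) : Prop :=
  (forall (x : Qp) (A : set padic_borel), measurable A ->
     mu [set x + y | y in (A : set Qp)] = mu A) /\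
  mu padic_int = 1%E.

Definition normalized (mu : {measure set padic_borel -> \bar R})
  (B A : set Qp) : \bar R := (mu (A `&` B) / mu B)%E.

End Haar.

Section Cosets.
Variables (R : realType) (p : nat) (p_pr : prime p).
Local Notation Qp := (padic p_pr).
Variables (k : nat) (n : 'I_k -> nat) (alpha : 'I_k -> R).

Definition padic_prod : Type := forall i : 'I_k, 'rV[Qp]_(n i).

(* m_i(delta) = ceil (alpha_i * log_p (1 / delta)). *)
Definition scale_exp (delta : R) (i : 'I_k) : int :=
  Num.ceil (alpha i * (ln delta^-1 / ln p%:R)).

Definition aniso_box (delta : R) : set padic_prod :=
  [set x | forall i, exists z : 'rV[Qp]_(n i),
     (forall l, padic_int R (z 0 l)) /\ x i = p%:R ^ scale_exp delta i *: z].

Definition aniso_coset (delta : R) (x : padic_prod) : set padic_prod :=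
  [set (fun i => x i + q i) | q in aniso_box delta].

(* The number of cosets that meet A, with value +oo if there are infinitely
   many. *)
Definition covering_number (delta : R) (A : set padic_prod) : \bar R :=
  counting [set X | (exists x, X = aniso_coset delta x) /\ X `&` A !=set0].

End Cosets.
Arguments covering_number {R p p_pr k n}.

Section PolynomialFamily.
Variables (R : realType) (p : nat) (p_pr : prime p).
Local Notation Qp := (padic p_pr).
Variables (k : nat) (n d : 'I_k -> nat).

(* The index (i, j) with 0 <= j <= d_i is an i : 'I_k and a j : 'I_(d i).+1. *)
Definition scalar_family : Type := forall i : 'I_k, 'I_(d i).+1 -> Qp.

Definition coef_space : Type :=
  forall i : 'I_k, 'I_(d i).+1 -> 'rV[Qp]_(n i).

Definition coef_norm (b : coef_space) : R :=
  \big[Num.max/0]_(i < k) \big[Num.max/0]_(j < (d i).+1)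
    \big[Num.max/0]_(l < n i) padic_norm R (b i j 0 l).

Definition poly_eval (a : scalar_family) (r : Qp) (v : coef_space) :
    padic_prod p_pr n :=
  fun i => \sum_(j < (d i).+1) (a i j * r ^+ j) *: v i j.

Definition absorbed (a : scalar_family) (E : set coef_space) : set coef_space :=
  [set (fun i j => a i j *: v i j) | v in E].

(* A supremum in \bar R; that it is attained and finite is part of the theorem. *)
Definition max_covering (a : scalar_family) (alpha : 'I_k -> R) (delta : R)
    (B : set Qp) (E : set coef_space) : \bar R :=
  ereal_sup [set covering_number alpha delta (poly_eval a s @` E) | s in B].

End PolynomialFamily.

(* Main.v *)
(* Proof idea.  Fix a base point s in B, write r = s + p^b x with x in Z_p, and
   rescale so that all coefficients are integral and all cosets are residue
   classes mod q = p^L, with L = O(1 + l).  The covering number at r is then the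
   number of residue vectors of the values of the polynomials at x.

   Lifting.  A degree-d coordinate y(x) is the image of d coordinates moving on
   lines z_j = a_j + x c_j under (z_j) |-> sum_j x^j z_j.  Adding all free choices
   of the intermediate coefficients multiplies the family and its images by the
   same factor, so it suffices to treat lines in Lambda dimensions; this is where
   the exponent Lambda comes from.

   Lines.  On the points x with v(x) = h, split the a's into classes mod p^h and
   divide by the unit part of x: the lines become c + t a, where the slopes a are
   distinct mod p^(L-h).  After a translation, a proportion (n0/q)^Lambda of the
   slopes lies in the box [0, n0)^Lambda.  For such slopes u consider
   F_(u,j) = W^j prod_i prod_(b < n0, b <> u_i) (Y_i - W^b), evaluated at
   W = zeta^t, Y = zeta^(c + t u) for a primitive q-th root of unity zeta.  If
   there were fewer points than such functions, some combination would vanish at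
   all points; restricted to a line it is a polynomial in W divisible by
   prod_t (W - zeta^t).  Specialising zeta to 1 in F_p removes the offsets c, turns
   the divisor into (W - 1)^#T, and separates the slopes, because the order of
   W^u - W^b at 1 is only p^v(u-b).  Minors detect the contradiction, as an integer
   polynomial vanishing at zeta has value divisible by p at 1. *)
Require Import Defs.
From HB Require Import structures.
From mathcomp Require Import all_boot all_order all_algebra all_field.
From mathcomp Require Import all_classical all_reals all_analysis.
From mathcomp Require Import zify ring lra.

Set Implicit Arguments.
Unset Strict Implicit.
Unset Printing Implicit Defensive.

Import Order.TTheory GRing.Theory Num.Theory.
Import numFieldNormedType.Exports.

Local Open Scope ring_scope.

(** * Linear algebra and cyclotomic integers *)

Lemma ker_more_cols (F : fieldType) (Row Col : finType) (E : Row -> Col -> F) :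
  (#|Row| < #|Col|)%N ->
  exists2 v : Col -> F, exists c, v c != 0 & forall r, \sum_c E r c * v c = 0.
Proof.
move=> ltRC; pose A := \matrix_(c < #|Col|, r < #|Row|) E (enum_val r) (enum_val c).
have ker0 : kermx A != 0.
  by rewrite -mxrank_eq0 mxrank_ker subn_eq0 -ltnNge (leq_ltn_trans (rank_leq_col _)).
have /rowV0Pn[u u_ker u0] := ker0.
have [c uc0] : exists c, u 0 c != 0.
  by apply/rV0Pn.
exists (fun c => u 0 (enum_rank c)).
  by exists (enum_val c); rewrite enum_valK.
move=> r; have /(congr1 (fun M : 'rV_ _ => M 0 (enum_rank r))) := sub_kermxP u_ker.
rewrite !mxE => uE; rewrite -[RHS]uE [RHS](reindex enum_rank) /=;
  last exact/onW_bij/enum_rank_bij.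
by apply: eq_bigr => i' _; rewrite !mxE !enum_rankK mulrC.
Qed.

(** Injectivity over [F1] yields [#|Col|] rows whose minor survives [f1]; over [F2] the kernel
    vector still solves those rows, so the same minor dies. *)
Lemma minor_separates (R0 : comNzRingType) (F1 F2 : fieldType)
    (f1 : {rmorphism R0 -> F1}) (f2 : {rmorphism R0 -> F2})
    (Row Col : finType) (B : Row -> Col -> R0) :
  (forall v : Col -> F1, (forall r, \sum_c f1 (B r c) * v c = 0) ->
     forall c, v c = 0) ->
  (exists2 v : Col -> F2, exists c, v c != 0 &
     forall r, \sum_c f2 (B r c) * v c = 0) ->
  exists2 m : R0, f1 m != 0 & f2 m = 0.
Proof.
move=> inj1 [v [c0 vc0] ker2].
pose A := \matrix_(r < #|Row|, c < #|Col|) B (enum_val r) (enum_val c).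
have full : row_full (map_mx f1 A).
  rewrite /row_full -mxrank_tr -/(row_free _) -kermx_eq0.
  apply/rowV0P => u /sub_kermxP uA; apply/rowP => c; rewrite mxE.
  rewrite -(enum_valK c); apply: (inj1 (fun c => u 0 (enum_rank c))) => r.
  have /(congr1 (fun M : 'rV_ _ => M 0 (enum_rank r))) := uA.
  rewrite !mxE => uE'; rewrite -[RHS]uE' [RHS](reindex enum_rank) /=;
    last exact/onW_bij/enum_rank_bij.
  by apply: eq_bigr => i' _; rewrite !mxE !enum_rankK mulrC.
exists (\det (rowsub (fullrankfun full) A)).
  rewrite -det_map_mx map_mxsub.
  by have := fullrowsub_full full; rewrite row_full_unit unitmxE unitfE.
rewrite -det_map_mx -det_tr; apply/eqP/det0P; exists (\row_c v (enum_val c)).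
  by apply/rV0Pn; exists (enum_rank c0); rewrite mxE enum_rankK.
apply/rowP => i; rewrite !mxE [LHS](reindex enum_rank) /=;
  last exact/onW_bij/enum_rank_bij.
rewrite -[RHS](ker2 (enum_val (fullrankfun full i))).
by apply: eq_bigr => c _; rewrite !mxE !enum_rankK mulrC.
Qed.

(** The divisors of p^L are p^L and those of p^(L-1), so the polynomial is the sum over i < p of
    X^(i p^(L-1)), and each of these p terms is 1 at 1. *)
Lemma Cyclotomic_pX (p L : nat) : prime p -> (0 < L)%N ->
  ('Phi_(p ^ L)).[1] = p%:R :> int.
Proof.
move=> p_pr L0; have p0 := prime_gt0 p_pr.
have dvE : perm_eq (divisors (p ^ L)) ((p ^ L)%N :: divisors (p ^ L.-1)).
  apply: uniq_perm; rewrite ?divisors_uniq //= ?divisors_uniq ?andbT.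
    rewrite -dvdn_divisors ?expn_gt0 ?p0 // dvdn_Pexp2l ?prime_gt1 //.
    by rewrite -ltnNge ltn_predL.
  move=> m; rewrite inE -!dvdn_divisors ?expn_gt0 ?p0 //.
  apply/idP/idP => [/dvdn_pfactor-/(_ p_pr)[j jL ->]|].
    have [->|jL'] := eqVneq j L; first by rewrite eqxx.
    by rewrite dvdn_exp2l ?orbT//; lia.
  by case/orP => [/eqP->//|]; move/dvdn_trans; apply; rewrite dvdn_exp2l ?leq_pred.
have E : 'Phi_(p ^ L) * ('X^(p ^ L.-1) - 1) = 'X^(p ^ L) - 1 :> {poly int}.
  rewrite -prod_Cyclotomic ?expn_gt0 ?p0 // -[RHS]prod_Cyclotomic ?expn_gt0 ?p0 //.
  by rewrite (perm_big _ dvE) /= big_cons.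
have -> : 'Phi_(p ^ L) = \sum_(i < p) ('X^(p ^ L.-1)) ^+ i :> {poly int}.
  have nz : 'X^(p ^ L.-1) - 1 != 0 :> {poly int}.
    by rewrite -size_poly_gt0 size_XnsubC ?expn_gt0 ?p0.
  apply: (mulIf nz); rewrite E mulrC -subrX1 -exprM -expnSr prednK //.
rewrite horner_sum (eq_bigr (fun=> 1)) ?sumr_const ?card_ord // => i _.
by rewrite !hornerE !expr1n.
Qed.

Lemma root_zeta_dvd (p L : nat) (z : algC) (m : {poly int}) :
  prime p -> (0 < L)%N -> (p ^ L).-primitive_root z ->
  (map_poly intr m).[z] = 0 -> (p%:Z %| m.[1])%Z.
Proof.
move=> p_pr L0 prz m0.
pose Phi := 'Phi_(p ^ L); have mon : Phi \is monic := Cyclotomic_monic _.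
have := Pdiv.RingMonic.rdivp_eq mon m.
set a := Pdiv.Ring.rdivp _ _; set r := Pdiv.Ring.rmodp _ _ => E.
have rsz : (size r < size Phi)%N by rewrite Pdiv.Ring.ltn_rmodpN0 ?monic_neq0.
have Phiz : (map_poly intr Phi).[z] = 0 :> algC.
  by rewrite (Cintr_Cyclotomic prz); apply/rootP; rewrite root_cyclotomic.
have r0 : (map_poly intr r).[z] = 0 :> algC.
  by move: m0; rewrite E rmorphD rmorphM /= hornerD hornerM Phiz mulr0 add0r.
suff -> : m.[1] = a.[1] * p%:Z.
  by rewrite dvdz_mull.
rewrite E hornerD hornerM Cyclotomic_pX //.
suff -> : r = 0 by rewrite horner0 addr0 natz.
(* A nonzero remainder would be a multiple of the minimal polynomial of [z] over the rationals,
   which has the same size as [Phi]. *)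
have [q [Eq monq] dvq] := minCpolyP z.
have qsz : size q = size Phi.
  rewrite -(size_map_poly (ratr : {rmorphism rat -> algC}))
    -Eq (minCpoly_cyclotomic prz).
  by rewrite /Phi size_Cyclotomic size_cyclotomic.
have := dvq (map_poly intr r).
rewrite -map_poly_comp (eq_map_poly (g := intr)) => [|x]; last by rewrite /= ratr_int.
rewrite rootE r0 eqxx => /esym dv; apply/eqP; apply: contraTT dv => rn0.
have rQ0 : map_poly intr r != 0 :> {poly rat}.
  rewrite -size_poly_eq0 size_map_inj_poly ?size_poly_eq0 //; exact: intr_inj.
apply/negP => /(dvdp_leq rQ0).
by rewrite size_map_inj_poly //; [rewrite qsz leqNgt rsz | exact: intr_inj].
Qed.

(** The summand is one of the powers p^a, a < L, with p^a dividing i; each a contributes at most p^a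
    floor(m / p^a) <= m. *)
Lemma sum_pfactor_le (p L m : nat) : prime p -> (m < p ^ L)%N ->
  (\sum_(1 <= i < m.+1) p ^ logn p i <= m * L)%N.
Proof.
move=> p_pr mL.
have le1 i : (0 < i < m.+1)%N ->
    (p ^ logn p i <= \sum_(a < L) p ^ a * (p ^ a %| i))%N.
  move=> /andP[i0 im]; have lL : (logn p i < L)%N.
    rewrite -(ltn_exp2l _ _ (prime_gt1 p_pr)); apply: leq_ltn_trans mL.
    by apply: leq_trans (im : (i <= m)%N); rewrite dvdn_leq ?pfactor_dvdnn.
  rewrite (bigD1 (Ordinal lL)) //= pfactor_dvdnn muln1; exact: leq_addr.
rewrite big_nat; apply: leq_trans (leq_sum _ le1) _; rewrite -big_nat exchange_big /=.
have -> : (m * L = \sum_(a < L) m)%N by rewrite sum_nat_const card_ord mulnC.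
apply: leq_sum => a _.
by rewrite -big_distrr /= -divn_count_dvd mulnC leq_divM.
Qed.

Definition nat_dist (m n : nat) := (m - n + (n - m))%N.

(** The distances from u to the other points of [0, n) are 1..u and 1..n-1-u, n - 1 in total. *)
Lemma sum_pfactor_dist_le (p L n u : nat) : prime p -> (n <= p ^ L)%N ->
  (u < n)%N ->
  (\sum_(c < n | c != u :> nat) p ^ logn p (nat_dist u c) <= n.-1 * L)%N.
Proof.
move=> p_pr nL un.
have -> : (\sum_(c < n | c != u :> nat) p ^ logn p (nat_dist u c) =
    \sum_(1 <= i < u.+1) p ^ logn p i + \sum_(1 <= i < (n.-1 - u).+1) p ^ logn p i)%N.
  rewrite -(big_mkord (fun c => c != u) (fun c => p ^ logn p (nat_dist u c))%N).
  rewrite (big_cat_nat (leq0n u) (ltnW un)) /= (big_ltn_cond un) eqxx /=.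
  congr (_ + _)%N.
    rewrite big_nat_rev /= add0n big_add1 /=.
    rewrite big_nat_cond [RHS]big_nat_cond.
    apply: eq_big => i; rewrite /nat_dist.
      by apply/idP/idP => H; lia.
    by case/andP=> /andP[_ iu] _; congr (p ^ logn p _)%N; lia.
  rewrite -{1}[u.+1]add0n big_addn big_add1 /=.
  have -> : (n - u.+1 = n.-1 - u)%N by lia.
  rewrite big_nat_cond [RHS]big_nat_cond.
  apply: eq_big => i; rewrite /nat_dist.
    by apply/idP/idP => H; lia.
  by case/andP=> /andP[_ iu] _; congr (p ^ logn p _)%N; lia.
apply: leq_trans (leq_add (@sum_pfactor_le p L u p_pr _)
  (@sum_pfactor_le p L (n.-1 - u) p_pr _)) _; try lia.
by rewrite -mulnDl leq_mul2r; apply/orP; right; lia.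
Qed.

(** Write the difference of the exponents as m p^v with m prime to p. Frobenius gives X^(m p^v) - 1
    = (X^m - 1)^(p^v), and 1 is a simple root of X^m - 1. *)
Lemma subXn_factor (p : nat) (F : fieldType) (u c : nat) : p \in [pchar F] ->
  u != c -> exists2 r : {poly F}, r.[1] != 0 &
    'X^u - 'X^c = ('X - 1) ^+ (p ^ logn p (nat_dist u c)) * r.
Proof.
move=> pF; have p_pr : prime p := pcharf_prime pF.
have pP : p \in [pchar {poly F}] by rewrite pchar_poly.
have key a b : (a < b)%N -> exists2 r : {poly F}, r.[1] != 0 &
    'X^b - 'X^a = ('X - 1) ^+ (p ^ logn p (b - a)) * r.
  move=> ab; have d0 : (0 < b - a)%N by rewrite subn_gt0.
  have [m pm Em] := pfactor_coprime p_pr d0.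
  set v := logn p (b - a) in Em *.
  have E : 'X^(b - a) - 1 = ('X^m - 1) ^+ (p ^ v) :> {poly F}.
    rewrite {1}Em exprM -{1}(subrK 1 ('X^m : {poly F})) exprDn_pchar ?expr1n ?addrK //.
    by rewrite pnatX (pnatE _ p_pr) pP.
  exists ('X^a * (\sum_(i < m) 'X^i) ^+ (p ^ v)).
    rewrite hornerM !horner_exp hornerX horner_sum (eq_bigr (fun=> 1)) => [|i _];
      last first.
      by rewrite !hornerE expr1n.
    rewrite expr1n mul1r expf_neq0 // sumr_const card_ord -(dvdn_pcharf pF).
    by rewrite -prime_coprime.
  rewrite -[in LHS](subnK (ltnW ab)) exprD -[X in _ - X]mul1r -mulrBl E subrX1 exprMn.
  by rewrite mulrCA mulrC mulrA.
rewrite /nat_dist; case: ltngtP => // uc _.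
  have [r r1 E] := key _ _ uc; exists (- r); first by rewrite hornerN oppr_eq0.
  by rewrite mulrN -(_ : (c - u = u - c + (c - u))%N) ?opprB//;
    [rewrite -E opprB | lia].
have [r r1 E] := key _ _ uc; exists r => //.
by rewrite -(_ : (u - c = u - c + (c - u))%N) //; lia.
Qed.

(** * The polynomial method *)

(** A ring morphism whose argument stands for the root of unity: the indeterminate is specialised
    both to a complex primitive root and to 1 in F_p. *)
Definition int_horner (F : comNzRingType) (a : F) (m : {poly int}) : F :=
  (map_poly intr m).[a].

HB.instance Definition _ (F : comNzRingType) (a : F) :=
  GRing.RMorphism.copy (int_horner a)
    (horner_eval a \o (map_poly (intr : int -> F))).

Lemma int_hornerX (F : comNzRingType) (a : F) n : int_horner a 'X^n = a ^+ n.
Proof. by rewrite /int_horner map_polyXn hornerXn. Qed.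

(** As [r] is prime to X - 1, [C] itself contains at least K - ord1 >= k factors X - 1, more than
    its degree allows. *)
Lemma Xsub1_dvd_eq0 (F : fieldType) (k n ord1 K : nat) (C r Z : {poly F}) :
  (size C <= k)%N -> r.[1] != 0 -> (ord1 <= n)%N -> (k + n <= K)%N ->
  C * (('X - 1) ^+ ord1 * r) = ('X - 1) ^+ K * Z -> C = 0.
Proof.
move=> Ck r1 On knK E.
have X1 : 'X - 1 != 0 :> {poly F} by rewrite -polyC1 polyXsubC_eq0.
have {}E : C * r = ('X - 1) ^+ (K - ord1) * Z.
  apply: (mulfI (expf_neq0 ord1 X1)); rewrite mulrCA [RHS]mulrA -exprD.
  by rewrite subnKC ?E //; lia.
have : ('X - 1) ^+ (K - ord1) %| C * r by rewrite E dvdp_mulr.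
rewrite Gauss_dvdpl; last first.
  by apply: coprimep_expl; rewrite -polyC1 coprimep_sym coprimep_XsubC.
move=> dv; apply/eqP; apply: contraTT dv => C0; apply/negP => /(dvdp_leq C0).
rewrite -polyC1 size_exp_XsubC => H.
by have := leq_trans H Ck; lia.
Qed.

Lemma prod_subXn_factor (p L n0 : nat) (F : fieldType) (J : finType) (u : J -> nat) :
  p \in [pchar F] -> (n0 <= p ^ L)%N -> (forall j, (u j < n0)%N) ->
  exists ord1 (r : {poly F}), [/\ r.[1] != 0, (ord1 <= #|J| * (n0.-1 * L))%N &
    \prod_j \prod_(c < n0 | c != u j :> nat) ('X^(u j) - 'X^c) =
      ('X - 1) ^+ ord1 * r].
Proof.
move=> pF nL un; have p_pr := pcharf_prime pF.
have key j : exists r : {poly F}, r.[1] != 0 /\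
    \prod_(c < n0 | c != u j :> nat) ('X^(u j) - 'X^c) =
    ('X - 1) ^+ (\sum_(c < n0 | c != u j :> nat) p ^ logn p (nat_dist (u j) c)) * r.
  pose f (c : 'I_n0) := fun r : {poly F} =>
    r.[1] != 0 /\ (c != u j :> nat -> 'X^(u j) - 'X^c = ('X - 1) ^+
      (p ^ logn p (nat_dist (u j) c)) * r).
  have fP c : exists r, f c r.
    have [E|ne] := eqVneq (c : nat) (u j); first by exists 1; split=> //;
      rewrite ?hornerE ?oner_eq0 ?E ?eqxx.
    rewrite eq_sym in ne; have [r r1 E] := subXn_factor pF ne; exists r; split=> //.
  have [r rP] := fin_all_exists fP.
  exists (\prod_(c < n0 | c != u j :> nat) r c); split.
    by rewrite horner_prod; apply/prodf_neq0 => c _; case: (rP c).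
  rewrite expr_sum -big_split /=; apply: eq_bigr => c cu.
  by case: (rP c) => _ ->.
have [r rP] := fin_all_exists key.
exists (\sum_j \sum_(c < n0 | c != u j :> nat) p ^ logn p (nat_dist (u j) c))%N.
exists (\prod_j r j); split.
- by rewrite horner_prod; apply/prodf_neq0 => c _; case: (rP c).
- rewrite -sum_nat_const; apply: leq_sum => j _; exact: sum_pfactor_dist_le.
- rewrite expr_sum -big_split /=; apply: eq_bigr => j _.
  by case: (rP j).
Qed.

Section PolynomialMethod.
Variables (p L : nat) (p_pr : prime p) (L_gt0 : (0 < L)%N).
Let q := (p ^ L)%N.
Variables (I J T X : finType) (n0 k : nat).
Variables (u c : I -> J -> nat) (x : T -> nat) (y : T -> I -> X).
Hypothesis n0q : (n0 <= q)%N.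
Hypothesis u_lt : forall i j, (u i j < n0)%N.
Hypothesis u_inj : forall i i', u i =1 u i' -> i = i'.
Hypothesis x_inj : forall t t', x t = x t' %[mod q] -> t = t'.
Hypothesis y_class : forall t i i', y t i = y t i' -> forall j,
  c i j + x t * u i j = c i' j + x t * u i' j %[mod q].
Hypothesis k_le : (k + #|J| * (n0.-1 * L) <= #|T|)%N.

(** The test function attached to the slope of line [ik.1] and the power [ik.2], restricted to line
    [i]. The outer variable is W, the inner one is zeta. *)
Let g (ik : I * 'I_k) (i : I) : {poly {poly int}} :=
  'X^(ik.2) * \prod_j \prod_(b < n0 | b != u ik.1 j :> nat)
    (('X^(c i j))%:P * 'X^(u i j) - 'X^b).

Let h : {poly {poly int}} := \prod_t ('X - ('X^(x t))%:P).

Let h_monic : h \is monic.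
Proof. by apply: monic_prod => t _; rewrite monicXsubC. Qed.

Let size_h : size h = #|T|.+1.
Proof. by rewrite size_prod_XsubC /index_enum -enumT -cardE. Qed.

Let Q ik i := Pdiv.Ring.rdivp (g ik i) h.
Let S ik i := Pdiv.Ring.rmodp (g ik i) h.
(** A kernel vector is a combination divisible by [h] on every line. The entries are integer
    polynomials in zeta, so minors can be compared across specialisations. *)
Let B (im : I * 'I_#|T|) ik : {poly int} := (S ik im.1)`_im.2.

Let gE ik i : g ik i = Q ik i * h + S ik i.
Proof. exact: Pdiv.RingMonic.rdivp_eq. Qed.

Let size_S ik i : (size (S ik i) <= #|T|)%N.
Proof. by rewrite -ltnS -size_h Pdiv.Ring.ltn_rmodpN0 // monic_neq0. Qed.

Section Specialize.
Variables (F : fieldType) (f : {rmorphism {poly int} -> F}) (v : I * 'I_k -> F).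

Let rem (i : I) := \sum_ik (v ik)%:P * map_poly f (S ik i).

Let coef_rem i m : (rem i)`_m = \sum_ik f ((S ik i)`_m) * v ik.
Proof.
by rewrite coef_sum; apply: eq_bigr => ik _; rewrite coefCM coef_map mulrC.
Qed.

Let size_rem i : (size (rem i) <= #|T|)%N.
Proof.
apply: leq_trans (size_sum _ _ _) _; apply/bigmax_leqP => ik _; rewrite mul_polyC.
by apply: leq_trans (size_scale_leq _ _) (leq_trans (size_poly _ _) _).
Qed.

Lemma sum_gE i : \sum_ik (v ik)%:P * map_poly f (g ik i) =
  map_poly f h * (\sum_ik (v ik)%:P * map_poly f (Q ik i)) + rem i.
Proof.
rewrite big_distrr -big_split /=; apply: eq_bigr => ik _.
by rewrite gE rmorphD rmorphM /=; ring.
Qed.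

Lemma rem_eq0 : (forall i, rem i = 0) <->
  (forall im, \sum_ik f (B im ik) * v ik = 0).
Proof.
split=> [r0 im|H i]; first by rewrite /B -coef_rem r0 coef0.
apply/polyP => m; rewrite coef0; case: (ltnP m #|T|) => mT.
  by rewrite coef_rem -[RHS](H (i, Ordinal mT)).
by rewrite nth_default // (leq_trans (size_rem i)).
Qed.

Lemma map_g ik i : map_poly f (g ik i) = 'X^(ik.2) *
  \prod_j \prod_(b < n0 | b != u ik.1 j :> nat)
    ((f 'X ^+ (c i j))%:P * 'X^(u i j) - 'X^b).
Proof.
rewrite rmorphM /= map_polyXn rmorph_prod; congr (_ * _).
apply: eq_bigr => j _; rewrite rmorph_prod; apply: eq_bigr => b _.
by rewrite rmorphB rmorphM /= map_polyC /= !map_polyXn rmorphXn.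
Qed.

Lemma map_h : map_poly f h = \prod_t ('X - (f 'X ^+ x t)%:P).
Proof.
rewrite rmorph_prod; apply: eq_bigr => t _.
by rewrite rmorphB /= map_polyX map_polyC /= rmorphXn.
Qed.

Lemma rem0_dvd : (forall im, \sum_ik f (B im ik) * v ik = 0) -> forall i,
  exists Z, \sum_ik (v ik)%:P * map_poly f (g ik i) = map_poly f h * Z.
Proof. by move/rem_eq0 => H i; rewrite sum_gE H addr0; eexists. Qed.

(** On each line the remainder has degree below [#|T|] but [#|T|] distinct roots. *)
Lemma roots_rem0 : injective (fun t => f 'X ^+ x t) ->
  (forall i t, (\sum_ik (v ik)%:P * map_poly f (g ik i)).[f 'X ^+ x t] = 0) ->
  forall im, \sum_ik f (B im ik) * v ik = 0.
Proof.
move=> inj H; apply/rem_eq0 => i; apply/eqP; apply: contraT => r0.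
have := max_poly_roots (rs := [seq f 'X ^+ x t | t <- enum T]) r0.
rewrite map_inj_uniq // enum_uniq size_map -cardE ltnNge size_rem.
move=> no_roots; suff: false by []; apply: no_roots => //.
apply/allP => _ /mapP[t _ ->]; apply/rootP.
have := H i t; rewrite sum_gE hornerD hornerM.
suff -> : (map_poly f h).[f 'X ^+ x t] = 0 by rewrite mul0r add0r.
by rewrite map_h horner_prod (bigD1 t) //= !hornerE subrr mul0r.
Qed.

End Specialize.

(** At zeta = 1 the offsets disappear and [h] becomes (W - 1)^#|T|. On line [i] only the functions
    of its own slope survive: they give a polynomial with k coefficients times a product of order at
    most |J| (n0 - 1) L at 1, and [k_le] forces the coefficients to vanish. *)
Let full_at_1 (v : I * 'I_k -> 'F_p) :
  (forall im, \sum_ik int_horner 1 (B im ik) * v ik = 0) -> forall ik, v ik = 0.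
Proof.
move=> /rem0_dvd H [i k0]; have [Z] := H i.
have f1 : int_horner (1 : 'F_p) 'X = 1 by rewrite -['X]expr1 int_hornerX expr1.
rewrite map_h /= f1 [X in X * Z](eq_bigr (fun=> 'X - 1)) => [|t _];
  last by rewrite expr1n polyC1.
rewrite prodr_const.
pose P := \prod_j \prod_(b < n0 | b != u i j :> nat) ('X^(u i j) - 'X^b) : {poly 'F_p}.
have -> : \sum_ik (v ik)%:P * map_poly (int_horner (1 : 'F_p)) (g ik i) =
    (\poly_(b < k) (oapp (fun b => v (i, b)) 0 (insub b))) * P.
  pose G i' b := (v (i', b))%:P * map_poly (int_horner (1 : 'F_p)) (g (i', b) i).
  rewrite (eq_bigr (fun ik => G ik.1 ik.2)) => [|[? ?] _] //.
  rewrite -(pair_bigA _ G) /= /G.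
  rewrite (bigD1 i) //= [X in _ + X]big1 => [|i' i'i]; last first.
    rewrite big1 // => b _; rewrite map_g /= f1.
    (* In a coordinate where the slopes differ, the factor with b = u i j reads W^b - W^b. *)
    have [j uj] : exists j, u i' j != u i j.
      apply/existsP; apply: contraNT i'i => /existsPn uE; apply/eqP/u_inj => j.
      by apply/eqP; have := uE j; rewrite negbK.
    rewrite (bigD1 j) //= (bigD1 (Ordinal (u_lt i j))) /=; last by rewrite eq_sym.
    by rewrite expr1n polyC1 mul1r subrr !mul0r !mulr0.
  rewrite addr0 poly_def big_distrl /=; apply: eq_bigr => b _.
  rewrite map_g /= f1 mulrA -mul_polyC valK /=; congr (_ * _ * _).
  apply: eq_bigr => j _; apply: eq_bigr => d _.
  by rewrite expr1n polyC1 mul1r.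
have pF : p \in [pchar 'F_p] by exact: pchar_Fp.
rewrite {}/P; have [ord1 [r [r1 On ->]]] := prod_subXn_factor pF n0q (u_lt i).
move/(Xsub1_dvd_eq0 (size_poly _ _) r1 On k_le) => /polyP/(_ k0).
by rewrite coef_poly ltn_ord coef0 valK.
Qed.

(** Too few points would give [B] a nonzero kernel at a primitive root, while at 1 in F_p its kernel
    is trivial. The separating minor vanishes at the root and is nonzero modulo p at 1, against
    [root_zeta_dvd]. *)
Theorem polynomial_method : (#|I| * k <= \sum_t #|[set y t i | i : I]|)%N.
Proof.
rewrite leqNgt; apply/negP => few.
have q0 : (0 < p ^ L)%N by rewrite expn_gt0 prime_gt0.
have [z prz] := C_prim_root_exists q0.
pose Row := {tw : T * X | tw.2 \in [set y tw.1 i | i : I]}.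
have cardRow : #|{: Row}| = (\sum_t #|[set y t i | i : I]|)%N.
  rewrite card_sig -sum1_card (eq_bigr _ (fun t _ => esym (sum1_card _))).
  by rewrite pair_big_dep.
(* A function is evaluated at a point through any line reaching it: [y_class] makes the choice
   irrelevant, and the default 0 is never reached. *)
pose E (tw : Row) (ik : I * 'I_k) : algC :=
  oapp (fun i => (map_poly (int_horner z) (g ik i)).[z ^+ x (val tw).1]) 0
    [pick i | y (val tw).1 i == (val tw).2].
have ltRC : (#|{: Row}| < #|{: I * 'I_k}|)%N.
  by rewrite cardRow card_prod card_ord.
have [v v0 vE] := ker_more_cols E ltRC.
have fz : int_horner z 'X = z by rewrite -['X]expr1 int_hornerX expr1.
have [m m1 m0] : exists2 m : {poly int}, int_horner (1 : 'F_p)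
  m != 0 & int_horner z m = 0.
  apply: (@minor_separates _ _ _ (int_horner 1) (int_horner z) _ _ B full_at_1).
  exists v => //; apply: roots_rem0.
    rewrite /= fz => t t' /eqP; rewrite (eq_prim_root_expr prz) => /eqP; exact: x_inj.
  move=> i t; rewrite /= fz.
  have rowP : y t i \in [set y t i | i : I] by rewrite imset_f.
  rewrite -[RHS](vE (exist _ (t, y t i) rowP)) horner_sum; apply: eq_bigr => ik _.
  rewrite hornerM hornerC mulrC /E /=; congr (_ * _).
  case: pickP => [i' /eqP yE|/(_ i)]; last by rewrite eqxx.
  rewrite /= !map_g /= !fz !hornerM !horner_prod; congr (_ * _).
  apply: eq_bigr => j _; rewrite !horner_prod; apply: eq_bigr => b _.
  rewrite !hornerE -!exprM -!exprD; congr (_ - _).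
  by apply/eqP; rewrite (eq_prim_root_expr prz); apply/eqP/y_class.
have /dvdzP[a ma] := root_zeta_dvd p_pr L_gt0 prz m0.
have m1E : int_horner (1 : 'F_p) m = (m.[1])%:~R.
  by rewrite /int_horner -[in RHS]horner_map /= ?rmorph1.
by move: m1; rewrite m1E ma intrM -[X in _ * X]/(p%:R) pchar_Fp_0 // mulr0 eqxx.
Qed.
End PolynomialMethod.

(** * Lines modulo p^L with arbitrary slopes *)

Section Lines.
Local Open Scope nat_scope.

Lemma card_shift_lt (q n0 a : nat) : n0 <= q ->
  n0 <= #|[pred b : 'I_q | (a + b) %% q < n0]|.
Proof.
move=> nq; have [->//|n_gt0] := posnP n0; have q0 : 0 < q by lia.
pose f (b : 'I_n0) : 'I_q := Ordinal (ltn_pmod (b + (q - a %% q)) q0).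
have fE b : (a + f b) %% q = b.
  rewrite /= modnDmr -modnDml.
  have -> : a %% q + (b + (q - a %% q)) = b + q by have := ltn_pmod a q0; lia.
  by rewrite modnDr modn_small // (leq_trans (ltn_ord b)).
have f_inj : injective f by move=> b b' E; apply: val_inj; rewrite /= -(fE b) E fE.
rewrite -[leqLHS]card_ord -(card_codom f_inj); apply: subset_leq_card.
by apply/fintype.subsetP => _ /codomP[b ->]; rewrite inE fE.
Qed.

(** Averages over the translations [tau] of the slopes: each slope enters the box for at least
    n0^|J| of them. Translating moves all lines alike at each time, so coincidences are preserved
    and [polynomial_method] applies to the slopes inside the box. *)
Lemma lines_count (p L : nat) (I J T X : finType) (n0 k : nat)
    (a c : I -> J -> nat) (x : T -> nat) (y : T -> I -> X) :
  prime p -> 0 < L -> n0 <= p ^ L ->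
  (forall i i', (forall j, a i j = a i' j %[mod p ^ L]) -> i = i') ->
  (forall t t', x t = x t' %[mod p ^ L] -> t = t') ->
  (forall t i i', y t i = y t i' -> forall j,
     c i j + x t * a i j = c i' j + x t * a i' j %[mod p ^ L]) ->
  k + #|J| * (n0.-1 * L) <= #|T| ->
  #|I| * n0 ^ #|J| * k <= (p ^ L) ^ #|J| * \sum_t #|[set y t i | i : I]|.
Proof.
move=> p_pr L0 n0q a_inj x_inj y_class k_le;
  set q := (p ^ L)%N in n0q a_inj x_inj y_class *.
pose P (tau : {ffun J -> 'I_q}) i := [forall j, (a i j + tau j) %% q < n0].
have P_count : #|I| * n0 ^ #|J| <= \sum_tau #|[pred i | P tau i]|.
  under eq_bigr do rewrite -sum1_card big_mkcond.
  rewrite exchange_big -sum_nat_const; apply: leq_sum => i _; rewrite -big_mkcond.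
  rewrite (eq_bigl (mem (family (fun j => [pred b : 'I_q | (a i j + b)
    %% q < n0])))); last first.
    by move=> tau; apply/forallP/familyP.
  rewrite sum1_card card_family foldrE big_map -prod_nat_const big_enum /=.
  by apply: leq_prod => j _; exact: card_shift_lt.
have P_le tau : #|[pred i | P tau i]| * k <= \sum_t #|[set y t i | i : I]|.
  pose I' := {i | P tau i}.
  pose u (i : I') j := (a (val i) j + tau j) %% q.
  have H : #|{: I'}| * k <= \sum_t #|[set y t (val i) | i : I']|.
    apply: (@polynomial_method p L p_pr L0 I' J T X n0 k u (fun i => c (val i)) x) =>
      //.
    - by move=> [i Pi] j; rewrite /u /=; exact: (forallP Pi).
    - move=> i i' uE; apply: val_inj; apply: a_inj => j.
      by apply/eqP; rewrite -(eqn_modDr (tau j)); apply/eqP/uE.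
    - move=> t i i' yE j; rewrite /u -!/q.
      rewrite -modnDmr modnMmr modnDmr -[in RHS]modnDmr modnMmr modnDmr.
      by rewrite !mulnDr !addnA; apply/eqP; rewrite eqn_modDr; apply/eqP/y_class.
  move: H; rewrite card_sig => /leq_trans; apply; apply: leq_sum => t _.
  apply: subset_leq_card; apply/fintype.subsetP => _ /imsetP[i _ ->]; exact: imset_f.
have : #|I| * n0 ^ #|J| * k <= (\sum_tau #|[pred i | P tau i]|) * k.
  by rewrite leq_mul2r P_count orbT.
move/leq_trans; apply; rewrite big_distrl /=.
have : \sum_tau #|[pred i | P tau i]| * k <=
    \sum_(tau : {ffun J -> 'I_q}) \sum_t #|[set y t i | i : I]|.
  by apply: leq_sum => tau _; exact: P_le.
by rewrite sum_nat_const card_ffun card_ord.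
Qed.

(** Labels determine the class, so the images of distinct classes are disjoint. *)
Lemma card_imset_classes (I E X : finType) (cls : I -> E) (y : I -> X) :
  (forall i i', y i = y i' -> cls i = cls i') ->
  \sum_e #|[set y (val i) | i : {i | cls i == e}]| <= #|[set y i | i : I]|.
Proof.
move=> y_cls; pose A e := [set y (val i) | i : {i | cls i == e}].
have AP e w : reflect (exists2 i, cls i = e & w = y i) (w \in A e).
  apply: (iffP imsetP) => [[[i ie] _ ->]|[i ie ->]]; first by exists i => //; apply/eqP.
  have ie' : cls i == e by apply/eqP.
  by exists (exist _ i ie').
rewrite -/(A _); under eq_bigr do rewrite -sum1_card.
rewrite (exchange_big_dep (mem [set y i | i : I])) /= => [|e w _ /AP[i _ ->]];
  last first.
  exact: imset_f.
rewrite -sum1_card; apply: leq_sum => _ /imsetP[i _ ->].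
rewrite (bigD1 (cls i)) /=; last by apply/AP; exists i.
rewrite big1 // => e /andP[/AP[i' <- /y_cls ->]]; by rewrite eqxx.
Qed.

End Lines.

(** * Valued fields with a p-adic norm *)

Section PadicNorms.
Variables (R : realType) (p : nat).

(** The counting argument is carried out over any field with these properties and with residues, and
    is applied to Q_p afterwards. *)
Record is_padic_norm (F : fieldType) (nrm : F -> R) : Prop := IsPadicNorm {
  pnorm_eq0 : forall x, (nrm x == 0) = (x == 0);
  pnormM : forall x y, nrm (x * y) = nrm x * nrm y;
  pnormD : forall x y, nrm (x + y) <= Num.max (nrm x) (nrm y);
  pnormN : forall x, nrm (- x) = nrm x;
  pnorm_nat : forall m : nat, (0 < m)%N -> nrm m%:R = p%:R ^- logn p m }.

(** Membership in p^m Z_p; negative m are allowed, so that rescaling is arithmetic on exponents. *)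
Definition pdvd (F : fieldType) (nrm : F -> R) (m : int) (x : F) : bool :=
  nrm x <= p%:R ^ (- m).

Definition has_residues (F : fieldType) (nrm : F -> R) : Prop :=
  forall (L : nat) (x : F), pdvd nrm 0 x ->
    exists2 m, (m < p ^ L)%N & pdvd nrm L (x - m%:R).

End PadicNorms.

Section PadicDivisibility.
Variables (R : realType) (p : nat) (p_pr : prime p).
Variables (F : fieldType) (nrm : F -> R).
Hypothesis nrmP : is_padic_norm p nrm.
Local Notation pdvd := (pdvd p nrm).

Let p_gt0 : 0 < p%:R :> R. Proof. by rewrite ltr0n prime_gt0. Qed.
Let p_neq0 : p%:R != 0 :> R. Proof. by rewrite gt_eqF. Qed.
Let p_ge1 : 1 <= p%:R :> R. Proof. by rewrite ler1n prime_gt0. Qed.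
Let p_gt1 : 1 < p%:R :> R. Proof. by rewrite ltr1n prime_gt1. Qed.

Lemma pnorm0 : nrm 0 = 0.
Proof. by apply/eqP; rewrite (pnorm_eq0 nrmP). Qed.

Lemma pnorm1 : nrm 1 = 1.
Proof. by rewrite -[1]/(1%:R) (pnorm_nat nrmP) // logn1 expr0 invr1. Qed.

Lemma pnorm_ge0 x : 0 <= nrm x.
Proof.
have := pnormD nrmP x (- x).
by rewrite subrr pnorm0 (pnormN nrmP) maxxx.
Qed.

Lemma pnormB x y : nrm (x - y) <= Num.max (nrm x) (nrm y).
Proof. by rewrite -(pnormN nrmP y) (pnormD nrmP). Qed.

Lemma pnormV x : nrm x^-1 = (nrm x)^-1.
Proof.
have [->|x0] := eqVneq x 0; first by rewrite invr0 pnorm0 invr0.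
have nx0 : nrm x != 0 by rewrite (pnorm_eq0 nrmP).
by apply: (mulfI nx0); rewrite -(pnormM nrmP) !divff ?pnorm1.
Qed.

Lemma pnormXz x (m : int) : nrm (x ^ m) = nrm x ^ m.
Proof.
have X k : nrm (x ^+ k) = nrm x ^+ k.
  by elim: k => [|k IH]; rewrite ?expr0 ?pnorm1 // !exprS (pnormM nrmP) IH.
by case: m => k; rewrite ?NegzE -?exprnP ?X// -!exprnN pnormV X.
Qed.

Lemma pnorm_p : nrm p%:R = p%:R^-1.
Proof. by rewrite (pnorm_nat nrmP) ?prime_gt0 // logn_prime // eqxx expr1. Qed.

Lemma p_neq0F : p%:R != 0 :> F.
Proof. by rewrite -(pnorm_eq0 nrmP) pnorm_p invr_eq0. Qed.

Lemma pdvd0 m : pdvd m 0.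
Proof. by rewrite /pdvd pnorm0 exprz_ge0 // ltW. Qed.

Lemma pdvdD m x y : pdvd m x -> pdvd m y -> pdvd m (x + y).
Proof. by rewrite /pdvd => hx hy; apply: le_trans (pnormD nrmP _ _) _;
  rewrite ge_max hx. Qed.

Lemma pdvdN m x : pdvd m (- x) = pdvd m x.
Proof. by rewrite /pdvd (pnormN nrmP). Qed.

Lemma pdvdB m x y : pdvd m x -> pdvd m y -> pdvd m (x - y).
Proof. by move=> hx hy; rewrite pdvdD ?pdvdN. Qed.

Lemma pdvdC m x y : pdvd m (x - y) = pdvd m (y - x).
Proof. by rewrite -pdvdN opprB. Qed.

Lemma pdvd_trans m y x z : pdvd m (x - y) -> pdvd m (y - z) -> pdvd m (x - z).
Proof. by move=> h1 h2; rewrite -(subrKA y) pdvdD. Qed.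

Lemma pdvdM m n x y : pdvd m x -> pdvd n y -> pdvd (m + n) (x * y).
Proof.
rewrite /pdvd (pnormM nrmP) opprD expfzDr // => hx hy.
by apply: ler_pM; rewrite ?pnorm_ge0.
Qed.

Lemma pdvdMl m x y : pdvd 0 x -> pdvd m y -> pdvd m (x * y).
Proof. by move=> hx hy; rewrite -[m]add0r pdvdM. Qed.

Lemma pdvdMr m x y : pdvd m x -> pdvd 0 y -> pdvd m (x * y).
Proof. by move=> hx hy; rewrite mulrC pdvdMl. Qed.

Lemma pdvd_sum m (I : Type) (r : seq I) (P : pred I) (f : I -> F) :
  (forall i, P i -> pdvd m (f i)) -> pdvd m (\sum_(i <- r | P i) f i).
Proof. by move=> H; elim/big_ind: _ => // [|x y]; [exact: pdvd0|exact: pdvdD]. Qed.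

Lemma pdvd_le (m n : int) x : m <= n -> pdvd n x -> pdvd m x.
Proof. by move=> mn /le_trans; apply; rewrite ler_weXz2l // lerN2. Qed.

Lemma pdvd_pM (n m : int) x : pdvd m (p%:R ^ n * x) = pdvd (m - n) x.
Proof.
rewrite /pdvd (pnormM nrmP) pnormXz pnorm_p exprz_inv mulrC.
by rewrite -ler_pdivlMr ?exprz_gt0 // invr_expz opprK -expfzDr // opprB addrC.
Qed.

Lemma pdvd_expz (m : int) : pdvd m (p%:R ^ m).
Proof. by rewrite -[_ ^ _]mulr1 pdvd_pM subrr /pdvd pnorm1 expr0z. Qed.

Lemma pdvd_nat (L m : nat) : pdvd L m%:R = (p ^ L %| m)%N.
Proof.
have [->|m0] := posnP m; first by rewrite pdvd0 dvdn0.
by rewrite /pdvd (pnorm_nat nrmP) // -exprnN lef_pV2 ?posrE ?exprn_gt0 //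
  ler_eXn2l // pfactor_dvdn.
Qed.

Lemma pdvd_int (L : nat) (m : int) : pdvd L m%:~R = (p ^ L %| `|m|)%N.
Proof.
case: m => m; first by rewrite -pdvd_nat.
by rewrite NegzE mulrNz pdvdN abszN -pdvd_nat.
Qed.

Lemma pnorm_int (m : int) : m != 0 -> nrm m%:~R = p%:R ^- logn p `|m|.
Proof.
case: m => m m0; first by rewrite -(pnorm_nat nrmP) // lt0n -eqz_nat.
by rewrite NegzE mulrNz (pnormN nrmP) abszN -(pnorm_nat nrmP).
Qed.

Lemma int_neq0F (m : int) : m != 0 -> m%:~R != 0 :> F.
Proof.
have nat_neq0 k : (k.+1%:R : F) != 0.
  rewrite -(pnorm_eq0 nrmP) (pnorm_nat nrmP) // invr_eq0 expf_neq0 //.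
case: m => [[|m]|m] // _; first exact: nat_neq0.
by rewrite NegzE mulrNz oppr_eq0 nat_neq0.
Qed.

Lemma pdvd_nat0 (m : nat) : pdvd 0 m%:R.
Proof. by rewrite pdvd_nat dvd1n. Qed.

Lemma pdvdX x k : pdvd 0 x -> pdvd 0 (x ^+ k).
Proof.
move=> hx; elim: k => [|k IH]; first by rewrite expr0 (pdvd_nat0 1).
by rewrite exprS pdvdMl.
Qed.

Lemma pdvd_nat_sub (L m n : nat) : pdvd L (m%:R - n%:R) = (m == n %[mod p ^ L]).
Proof.
wlog mn : m n / (n <= m)%N => [H|].
  by have [/H//|/ltnW/H] := leqP n m; rewrite pdvdC eq_sym.
by rewrite -natrB // pdvd_nat eqn_mod_dvd.
Qed.

Lemma padic_modulus_gt0 (L : nat) : (0 < p ^ L)%N.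
Proof. by rewrite expn_gt0 prime_gt0. Qed.

(* On a p-adic integer this is the residue mod p^L; elsewhere it is junk. *)
Definition padic_res (L : nat) (x : F) : 'I_(p ^ L) :=
  Ordinal (ltn_pmod (xget 0%N [set m : nat | pdvd L (x - m%:R)]%classic)
    (padic_modulus_gt0 L)).

Hypothesis nrm_res : has_residues p nrm.

Lemma padic_resP (L : nat) x : pdvd 0 x -> pdvd L (x - (padic_res L x)%:R).
Proof.
move=> x0; rewrite /padic_res /=; case: xgetP => [m -> /= xm|none].
  by apply: pdvd_trans xm _; rewrite pdvd_nat_sub modn_mod.
by have [m _ xm] := nrm_res L x0; case: (none m).
Qed.

Lemma eq_padic_res (L : nat) x y : pdvd 0 x -> pdvd 0 y ->
  (padic_res L x = padic_res L y) <-> pdvd L (x - y).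
Proof.
move=> x0 y0; have hx := padic_resP L x0; have hy := padic_resP L y0.
split=> [E|xy]; first by apply: pdvd_trans hx _; rewrite E pdvdC.
apply: ord_inj; apply/eqP; rewrite -(modn_small (ltn_ord (padic_res L x))).
rewrite -[X in _ == X](modn_small (ltn_ord (padic_res L y))) -pdvd_nat_sub.
apply: pdvd_trans hy; rewrite pdvdC in hx.
exact: pdvd_trans hx xy.
Qed.

Lemma eqmod_padic_res (L : nat) x y : pdvd 0 x -> pdvd 0 y ->
  (padic_res L x = padic_res L y %[mod p ^ L])%N <-> pdvd L (x - y).
Proof.
move=> x0 y0; rewrite -(eq_padic_res L x0 y0); split=> [|-> //].
by rewrite !modn_small ?ltn_ord // => /ord_inj.
Qed.

Lemma pdvd_natV (m : nat) : ~~ (p %| m)%N -> pdvd 0 (m%:R^-1 : F).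
Proof.
move=> pm; have m0 : (0 < m)%N by case: m pm => //; rewrite dvdn0.
by rewrite /pdvd (pnormV) (pnorm_nat nrmP) // lognE (negbTE pm)
  !andbF expr0 !invr1 oppr0 expr0z.
Qed.

Lemma padic_res_line (L : nat) c x a : pdvd 0 c -> pdvd 0 x -> pdvd 0 a ->
  pdvd L ((padic_res L c + padic_res L x * padic_res L a)%:R - (c + x * a)).
Proof.
move=> c0 x0 a0; rewrite natrD natrM; set cr := _%:R; set xr := _%:R; set ar := _%:R.
have -> : cr + xr * ar - (c + x * a) = (cr - c) + (xr * (ar - a) + (xr - x) * a)
  by ring.
have resN z : pdvd 0 z -> pdvd L ((padic_res L z)%:R - z).
  by move=> z0; rewrite pdvdC padic_resP.
by apply: pdvdD; [exact: resN | apply: pdvdD; [apply: pdvdMl;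
  rewrite ?pdvd_nat0 ?resN | apply: pdvdMr; rewrite ?resN]].
Qed.

(** * Lines with p-adic coefficients, sorted by the valuation of the time *)

Section LinesCount.
Variables (L : nat) (I J X : finType) (a c : I -> J -> F) (y : nat -> I -> X).
Variables (G : {set 'I_(p ^ L)}) (N : nat).
Hypothesis a_int : forall i j, pdvd 0 (a i j).
Hypothesis c_int : forall i j, pdvd 0 (c i j).
Hypothesis a_inj : forall i i', (forall j, pdvd L (a i j - a i' j)) -> i = i'.
Hypothesis y_class : forall t : 'I_(p ^ L), t \in G -> forall i i', y t i = y t i' ->
  forall j, pdvd L ((a i j + t%:R * c i j) - (a i' j + t%:R * c i' j)).
Hypothesis G_gt0 : forall t : 'I_(p ^ L), t \in G -> (0 < t)%N.
Hypothesis y_le : forall t : 'I_(p ^ L), t \in G -> (#|[set y t i | i : I]| <= N)%N.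

Section Level.
Variable h : nat.
Hypothesis hL : (h < L)%N.
Let Gh := [set t in G | logn p (t : 'I_(p ^ L)) == h].
Let T := {t | t \in Gh}.
(** For t = p^h w with w prime to p, a + t c = cls + p^h w (c + w^-1 a'). Hence a' becomes the
    slope, c the offset and w^-1 the time. *)
Let x (t : T) : F := ((val t : 'I_(p ^ L)) %/ p ^ h)%:R^-1.
Let cls i := [ffun j => padic_res h (a i j)].
Let a' i j : F := p%:R ^ (- (h : int)) * (a i j - (cls i j)%:R).

Let tE (t : T) : [/\ (val t \in G),
  ~~ (p %| val t %/ p ^ h)%N & (val t = val t %/ p ^ h * p ^ h :> nat)%N].
Proof.
case: t => t /=; rewrite inE => /andP[tG /eqP th].
have dv : (p ^ h %| t)%N by rewrite -th pfactor_dvdnn.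
rewrite divnK //; split=> //; apply/negP => pd.
have : (p ^ h.+1 %| t)%N by rewrite expnS -(divnK dv) dvdn_mul.
by rewrite pfactor_dvdn ?G_gt0 // th ltnn.
Qed.

Let x_int t : pdvd 0 (x t).
Proof. by have [_ ? _] := tE t; exact: pdvd_natV. Qed.

Let aE i j : a i j = (cls i j)%:R + p%:R ^ (h : int) * a' i j.
Proof.
by rewrite /a' mulrA -expfzDr ?p_neq0F // subrr expr0z mul1r addrC subrK.
Qed.

Let a'_int i j : pdvd 0 (a' i j).
Proof. by rewrite /a' pdvd_pM opprK add0r ffunE padic_resP. Qed.

Let tpos (t : T) : ((val t : 'I_(p ^ L)) %/ p ^ h)%:R != 0 :> F.
Proof.
by have [_ pd _] := tE t; apply: (int_neq0F (m := _%:Z)); rewrite eqz_nat -lt0n;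
  case: (_ %/ _)%N pd; rewrite ?dvdn0.
Qed.

Let natE (t : T) : ((val t : 'I_(p ^ L)) : nat)%:R = p%:R ^ (h : int) * (x t)^-1 :> F.
Proof.
have [_ _ E] := tE t; rewrite {1}E natrM natrX -exprnP mulrC /x invrK //.
Qed.

(** With t = p^h w and t' = p^h w', t - t' = p^h w w' (x t' - x t). *)
Let x_inj t t' : (padic_res (L - h) (x t) = padic_res (L - h) (x t')
  %[mod p ^ (L - h)])%N -> t = t'.
Proof.
move/eqmod_padic_res => /(_ (x_int t) (x_int t')) H.
apply: val_inj; apply: ord_inj; apply/eqP.
rewrite -(modn_small (ltn_ord (val t))) -[X in _ == X](modn_small (ltn_ord (val t'))).
rewrite -pdvd_nat_sub !natE -mulrBr pdvd_pM.
have -> : (x t)^-1 - (x t')^-1 = ((val t : 'I_(p ^ L)) %/ p ^ h)%:R *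
  ((val t' : 'I_(p ^ L)) %/ p ^ h)%:R * (x t' - x t).
  by rewrite /x !invrK; field; rewrite !tpos.
apply: pdvdMl; first by rewrite -natrM pdvd_nat0.
by rewrite pdvdC subzn // ltnW.
Qed.

Lemma card_level : (#|Gh| <= p ^ (L - h))%N.
Proof.
have inj : injective (fun t => padic_res (L - h) (x t)).
  by move=> t t' E; apply: x_inj; rewrite E.
by have := leq_card _ inj; rewrite card_sig card_ord; congr (_ <= _)%N; apply: eq_card.
Qed.

(** Since p^h divides t, the point at time t agrees with [a i] modulo p^h. *)
Let same_class t i i' : t \in Gh -> y t i = y t i' -> cls i = cls i'.
Proof.
rewrite inE => /andP[tG /eqP th] yE; apply/ffunP => j; rewrite !ffunE.
apply/(eq_padic_res h (a_int i j) (a_int i' j)).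
have H := y_class tG yE j.
have th' : pdvd h (t%:R : F) by rewrite pdvd_nat -th pfactor_dvdnn.
have -> : a i j - a i' j = (a i j + t%:R * c i j - (a i' j + t%:R * c i' j)) - t%:R *
  (c i j - c i' j) by ring.
apply: pdvdB; first by apply: pdvd_le H; rewrite lez_nat ltnW.
by apply: pdvdMr th' _; exact: pdvdB.
Qed.

(** Within a class modulo p^h the a' are distinct modulo p^(L-h), so [lines_count] applies; by
    [same_class] the estimates of the classes add up. *)
Lemma level_count (n0 k : nat) :
  (n0 <= p ^ (L - h))%N -> (k + #|J| * (n0.-1 * (L - h)) <= #|Gh|)%N ->
  (#|I| * n0 ^ #|J| * k <= (p ^ (L - h)) ^ #|J| * (#|Gh| * N))%N.
Proof.
move=> n0q kle; pose r z := padic_res (L - h) z.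
have classes e : (#|[pred i | cls i == e]| * n0 ^ #|J| * k <=
    (p ^ (L - h)) ^ #|J| * \sum_(t : T) #|[set y (val t) (val i)
      | i : {i | cls i == e}]|)%N.
  rewrite -[X in (X * _ * _ <= _)%N]card_sig.
  apply: (@lines_count p (L - h) {i | cls i == e} J T X n0 k
    (fun i j => r (a' (val i) j)) (fun i j => r (c (val i) j)) (fun t => r (x t))
    (fun t i => y (val t) (val i))) => //.
  - by rewrite subn_gt0.
  - move=> [i ie0] [i' ie0'] H; have ie := eqP ie0; have ie' := eqP ie0';
    apply: val_inj => /=; apply: a_inj => j.
    rewrite (aE i) (aE i') ie ie' opprD addrACA subrr add0r -mulrBr pdvd_pM.
    rewrite subzn ?(ltnW hL) //.
    by apply/(eqmod_padic_res _ (a'_int _ _) (a'_int _ _)); exact: H.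
  - move=> t [i ie0] [i' ie0'] /= yE j; have ie := eqP ie0; have ie' := eqP ie0'.
    apply/eqP; rewrite -pdvd_nat_sub.
    apply: pdvd_trans (padic_res_line _ (c_int i j) (x_int t) (a'_int i j)) _.
    rewrite pdvdC; apply: pdvd_trans (padic_res_line _ (c_int i' j) (x_int t)
      (a'_int i' j)) _.
    have [tG _ _] := tE t; have := y_class tG yE j; rewrite natE (aE i) (aE i') ie ie'.
    have -> : (e j)%:R + p%:R ^ h * a' i j + p%:R ^ h * (x t)^-1 * c i j -
        ((e j)%:R + p%:R ^ h * a' i' j + p%:R ^ h * (x t)^-1 * c i' j) =
      p%:R ^ h * ((x t)^-1 * (c i j + x t * a' i j - (c i' j + x t * a' i' j))).
      by have := tpos t; rewrite /x invrK => ?; field.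
    rewrite pdvd_pM subzn ?(ltnW hL) // => H.
    have xK z : z = x t * ((x t)^-1 * z) by rewrite mulrA divff ?mul1r // invr_eq0 tpos.
    by rewrite pdvdC (xK (c i j + x t * a' i j - _)); apply: pdvdMl.
  - rewrite card_sig; apply: leq_trans kle _; apply: eq_leq; exact: eq_card.
have cardI : (#|I| = \sum_e #|[pred i | cls i == e]|)%N.
  rewrite -sum1_card (partition_big cls predT) //=; apply: eq_bigr => e _.
  by rewrite -sum1_card.
rewrite cardI !big_distrl /=.
pose W e := (\sum_(t : T) #|[set y (val t) (val i) | i : {i | cls i == e}]|)%N.
apply: (@leq_trans (\sum_e (p ^ (L - h)) ^ #|J| * W e)%N).
  by apply: leq_sum => e _; exact: classes.
rewrite -big_distrr /= leq_mul2l; apply/orP; right.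
rewrite exchange_big /=; apply: (@leq_trans (\sum_(t : T) N)%N).
  apply: leq_sum => t _; apply: leq_trans (_ : #|[set y (val t) i | i : I]| <= N)%N.
    apply: card_imset_classes => i i'; apply: same_class; exact: valP.
  by apply: y_le; have [] := tE t.
by rewrite sum_nat_const card_sig leq_mul2r; apply/orP; right; apply: eq_leq;
  apply: eq_card.
Qed.

End Level.

(** If every level had fewer than |G| / (2 p^h) elements, then, as p >= 2, the levels would sum to
    less than |G| (1/2 + 1/4 + ...). *)
Lemma level_exists : (0 < #|G|)%N ->
  exists2 h, (h < L)%N & (#|G| <= 2 * p ^ h * #|[set t in G | logn p (t : 'I_(p ^ L))
    == h]|)%N.
Proof.
move=> G_pos; pose Kh h := #|[set t in G | logn p (t : 'I_(p ^ L)) == h]|.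
suff : ~~ [forall h : 'I_L, (2 * p ^ h * Kh h < #|G|)%N].
  by rewrite negb_forall => /existsP[h]; rewrite -leqNgt => H; exists h.
apply/negP => /forallP small.
have logL (t : 'I_(p ^ L)) : t \in G -> (logn p t < L)%N.
  move=> tG; rewrite -(ltn_exp2l _ _ (prime_gt1 p_pr)).
  by apply: leq_ltn_trans (ltn_ord t); rewrite dvdn_leq ?G_gt0 ?pfactor_dvdnn.
have L0 : (0 < L)%N by have /card_gt0P[t /logL] := G_pos; apply: leq_ltn_trans.
have cardG : (#|G| = \sum_(h < L) Kh h)%N.
  pose f (t : 'I_(p ^ L)) : 'I_L := insubd (Ordinal L0) (logn p t).
  rewrite -sum1_card (partition_big f predT) //=; apply: eq_bigr => h _.
  rewrite /Kh -sum1_card; apply: eq_bigl => t; rewrite inE.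
  by case tG: (t \in G) => //=; rewrite -val_eqE /= val_insubd logL.
have le1 (h : 'I_L) : (2 ^ L * Kh h <= 2 ^ (L.-1 - h) * #|G|.-1)%N.
  have hL : (h <= L.-1)%N by rewrite -ltnS prednK.
  have -> : (2 ^ L = 2 ^ (L.-1 - h) * (2 * 2 ^ h))%N.
    by rewrite mulnCA -expnD subnK // -expnS prednK.
  rewrite -mulnA leq_mul2l; apply/orP; right.
  rewrite -ltnS prednK //; apply: leq_ltn_trans (small h).
  by rewrite leq_mul2r leq_mul2l orbC /=; case: (posnP h) => [->//|h0];
    rewrite leq_exp2r ?prime_gt1 ?orbT.
have : (2 ^ L * #|G| <= (2 ^ L).-1 * #|G|.-1)%N.
  rewrite {1}cardG big_distrr /=; apply: (leq_trans (leq_sum _ (fun h _ => le1 h))).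
  rewrite -big_distrl /= leq_mul2r predn_exp mul1n; apply/orP; right.
  by rewrite (reindex_inj rev_ord_inj) /=; apply: leq_sum => h _;
    rewrite leq_exp2l //; have := ltn_ord h; lia.
have q0 : (0 < 2 ^ L)%N by rewrite expn_gt0.
by case: #|G| G_pos => // g _; move: q0; case: (2 ^ L)%N => // Q _ /=; nia.
Qed.

Lemma lines_bound : (0 < #|J|)%N -> (0 < L)%N ->
  (#|I| * #|G| ^ #|J| <= 2 * (4 * #|J| * L * p ^ L) ^ #|J| * N)%N.
Proof.
move=> J0 L0; have [->|G0] := posnP #|G|; first by rewrite exp0n // muln0.
have [h hL] := level_exists G0; set Gh := [set t in G | _]; set K := #|Gh| => GK.
have K0 : (0 < K)%N by move: GK; case: (K) => //; rewrite muln0 leqNgt G0.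
(* [D] is chosen so that the order lost, |J| (n0 - 1) (L - h), is at most K / 2, and [k] keeps half
   of the times. The successor in [n0] gives K <= n0 D even when K < D. *)
set D := (2 * #|J| * L)%N; have D0 : (0 < D)%N by rewrite !muln_gt0 J0 L0.
set e := (K %/ D)%N; have eK : (e * D <= K)%N by exact: leq_divM.
set n0 := e.+1; have Kn0 : (K <= n0 * D)%N by apply/ltnW/ltn_ceil.
set k := (K - #|J| * (e * (L - h)))%N.
have eL : (2 * (#|J| * (e * (L - h))) <= K)%N.
  by apply: leq_trans eK; rewrite (_ : e * D = 2 * (#|J| * (e * L)))%N;
    [by rewrite !leq_mul2l leq_subr !orbT | rewrite /D; ring].
have k2 : (K <= 2 * k)%N by rewrite /k; lia.
have n0q : (n0 <= p ^ (L - h))%N.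
  apply: leq_trans (card_level hL); rewrite -/Gh -/K.
  by have : (e * 2 <= K)%N; [apply: leq_trans eK; rewrite leq_mul2l /D; apply/orP;
    right; nia | lia].
have kle : (k + #|J| * (n0.-1 * (L - h)) <= K)%N by rewrite /k /n0 subnK //;
  apply: leq_trans eL; rewrite leq_pmull.
have H := level_count hL n0q kle.
have {}H : (#|I| * n0 ^ #|J| <= 2 * (p ^ (L - h)) ^ #|J| * N)%N.
  rewrite -(leq_pmul2r K0); apply: (@leq_trans (#|I| * n0 ^ #|J| * (2 * k))%N).
    by rewrite leq_mul2l k2 orbT.
  rewrite mulnCA -!mulnA leq_mul2l /=; move: H; rewrite -/Gh -/K.
  by rewrite -!mulnA [(N * K)%N]mulnC.
(* The factor p^h lost in passing to one level is compensated by the smaller modulus p^(L-h). *)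
have GKn : (#|G| <= n0 * (4 * #|J| * L * p ^ h))%N.
  apply: leq_trans GK _; apply: (@leq_trans (2 * p ^ h * (n0 * D))%N);
    first by rewrite leq_mul2l Kn0 orbT.
  by rewrite /D; apply: eq_leq; ring.
apply: (@leq_trans (#|I| * (n0 * (4 * #|J| * L * p ^ h)) ^ #|J|)%N).
  by rewrite leq_mul2l leq_exp2r // GKn orbT.
rewrite expnMn mulnA.
apply: (@leq_trans (2 * (p ^ (L - h)) ^ #|J| * N * (4 * #|J| * L * p ^ h) ^ #|J|)%N).
  by rewrite leq_mul2r H orbT.
have -> : (4 * #|J| * L * p ^ L = p ^ (L - h) * (4 * #|J| * L * p ^ h))%N.
  by rewrite mulnCA -expnD subnK // ltnW.
by rewrite [X in (_ <= _ * X * _)%N]expnMn !mulnA [(_ * N * _)%N]mulnAC.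
Qed.

End LinesCount.

(** * Lifting polynomials to lines in Lambda dimensions *)

Section PolynomialsBound.
Variables (L : nat) (I D X : finType) (d : D -> nat) (b : I -> D -> nat -> F).
Variables (y : nat -> I -> X) (G : {set 'I_(p ^ L)}) (N : nat).
Hypothesis b_int : forall i l j, pdvd 0 (b i l j).
Hypothesis b_inj : forall i i', (forall l, pdvd L (b i l 0 - b i' l 0)) -> i = i'.
Hypothesis y_class : forall t : 'I_(p ^ L), t \in G -> forall i i', y t i = y t i' ->
  forall l, pdvd L (\sum_(j < (d l).+1) t%:R ^+ j * b i l j -
                    \sum_(j < (d l).+1) t%:R ^+ j * b i' l j).
Hypothesis G_gt0 : forall t : 'I_(p ^ L), t \in G -> (0 < t)%N.
Hypothesis y_le : forall t : 'I_(p ^ L), t \in G -> (#|[set y t i | i : I]| <= N)%N.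

Let D1 : finType := {l : D & 'I_(d l).-1}.
Let J : finType := {l : D & 'I_(d l).-1.+1}.
Let Gam : finType := {ffun D1 -> 'I_(p ^ L)}.
(** The default 0 at j = d l - 1 ends the telescoping. *)
Let gv (g : Gam) l (j : nat) : F :=
  oapp (fun j' : 'I_(d l).-1 => (g (existT _ l j' : D1))%:R) 0 (insub j).
Let aa (ig : I * Gam) l j := if j is j'.+1 then gv ig.2 l j' else b ig.1 l 0.
(** A coordinate of degree 0 becomes one constant line, whence the maximum with 1 in [Lam]. *)
Let cc (ig : I * Gam) l j := if d l == 0 then 0 else b ig.1 l j.+1 - gv ig.2 l j.
Let zz (t : nat) ig l j := aa ig l j + t%:R * cc ig l j.
Let Y t ig := (y t ig.1, [ffun x : D1 => padic_res L (zz t ig (tag x) (tagged x).+1)]).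

Let gv_int g l j : pdvd 0 (gv g l j).
Proof. by rewrite /gv; case: insubP => [? _ _|_] /=; rewrite ?pdvd_nat0 ?pdvd0. Qed.

Let aa_int ig l j : pdvd 0 (aa ig l j).
Proof. by case: j => [|j]; rewrite /aa. Qed.

Let cc_int ig l j : pdvd 0 (cc ig l j).
Proof. by rewrite /cc; case: ifP => _; rewrite ?pdvd0 ?pdvdB. Qed.

Let zz_int t ig l j : pdvd 0 (zz t ig l j).
Proof. by rewrite pdvdD // pdvdMl ?pdvd_nat0. Qed.

(* The free coefficients gv telescope away. *)
Let sum_zz t ig l : \sum_(j < (d l).-1.+1) t%:R ^+ j * zz t ig l j =
  \sum_(j < (d l).+1) t%:R ^+ j * b ig.1 l j.
Proof.
rewrite /zz /cc; case dl: (d l) => [|m] /=.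
  by rewrite !big_ord1 /= mulr0 addr0.
have gm : gv ig.2 l m = 0 by rewrite /gv insubF // dl ltnn.
under eq_bigr => j _ do rewrite mulrDr mulrA -exprSr mulrBr.
rewrite big_split sumrB /= big_ord_recl [RHS]big_ord_recl /=.
rewrite [X in _ + (_ - X)]big_ord_recr /= gm mulr0 addr0.
rewrite -addrA; congr (_ + _).
exact: etrans (addrC _ _) (subrK _ _).
Qed.

Let Lam := (\sum_l maxn 1 (d l))%N.

(** Each member has (p^L)^#|D1| lifts, and recording the residues of z_1, z_2, ... enlarges the set
    of labels by at most the same factor, which cancels. *)
Lemma polynomials_bound : (0 < #|D|)%N -> (0 < L)%N ->
  (#|I| * #|G| ^ Lam <= 2 * (4 * Lam * L * p ^ L) ^ Lam * N)%N.
Proof.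
move=> D0 L0; have q0 := padic_modulus_gt0 L.
have cardJ : #|J| = Lam.
  rewrite card_tagged sumnE big_map big_enum /=; apply: eq_bigr => l _.
  by rewrite card_ord; case: (d l) => [|[]].
have J0 : (0 < #|J|)%N.
  rewrite cardJ; have /card_gt0P[l _] := D0.
  by rewrite /Lam (bigD1 l) //= addn_gt0 leq_max.
have Y_inj ig ig' : (forall lj : J, pdvd L (aa ig (tag lj) (tagged lj)
  - aa ig' (tag lj) (tagged lj))) -> ig = ig'.
  case: ig ig' => [i g] [i' g'] H; congr (_, _).
    by apply: b_inj => l; exact: (H (existT _ l ord0 : J)).
  apply/ffunP => -[l j]; apply: ord_inj.
  have := H (existT _ l (lift ord0 j) : J).
  rewrite /= /gv !valK /= pdvd_nat_sub !modn_small ?ltn_ord //.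
  by move/eqP.
have Y_class (t : 'I_(p ^ L)) : t \in G -> forall ig ig', Y t ig = Y t ig' ->
    forall lj : J, pdvd L (zz t ig (tag lj) (tagged lj) - zz t ig' (tag lj)
      (tagged lj)).
  move=> tG ig ig' [yE /ffunP zE].
  have zS l (j : 'I_(d l).-1) : pdvd L (zz t ig l j.+1 - zz t ig' l j.+1).
    apply/(eq_padic_res L (zz_int _ _ _ _) (zz_int _ _ _ _)).
    by have := zE (existT _ l j : D1); rewrite !ffunE.
  case=> l [[|j] jl] /=; last by exact: (zS l (Ordinal (jl : (j < _)%N))).
  (* z_0 is recovered modulo p^L from the value of the polynomial and the other z_j. *)
  have := y_class tG yE l;
    rewrite -!sum_zz !big_ord_recl !expr0 !mul1r opprD addrACA -sumrB => H.
  rewrite -[X in pdvd _ X](addrK (\sum_(j < (d l).-1)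
     (t%:R ^+ lift ord0 j * zz t ig l (lift ord0 j) - t%:R ^+ lift ord0 j *
       zz t ig' l (lift ord0 j)))).
  apply: pdvdB; first exact: H.
  by apply: pdvd_sum => j _; rewrite -mulrBr; apply: pdvdMl;
    rewrite ?pdvdX ?pdvd_nat0 ?zS.
have Y_le (t : 'I_(p ^ L)) : t \in G -> (#|[set Y t ig | ig : I * Gam]| <= N *
  (p ^ L) ^ #|D1|)%N.
  move=> tG; apply: (@leq_trans #|finset.setX [set y t i | i : I] [set: Gam]|).
    apply: subset_leq_card; apply/fintype.subsetP => _ /imsetP[ig _ ->].
    by rewrite inE /= imset_f ?inE.
  by rewrite cardsX cardsT card_ffun card_ord leq_mul2r y_le // orbT.
have := @lines_bound L (I * Gam)%type J _ (fun ig lj => aa ig (tag lj) (tagged lj))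
  (fun ig lj => cc ig (tag lj) (tagged lj)) Y G _ (fun _ _ => aa_int _ _ _) (fun _ _
    => cc_int _ _ _)
  Y_inj Y_class G_gt0 Y_le J0 L0.
rewrite cardJ card_prod card_ffun card_ord mulnA [(#|I| * _ * _)%N]mulnAC leq_pmul2r //.
by rewrite expn_gt0 q0.
Qed.

End PolynomialsBound.

End PadicDivisibility.

(** * The norm of Q_p and its residues *)

Section PadicInstance.
Variables (R : realType) (p : nat) (p_pr : prime p).
Local Notation Qp := (padic p_pr).
Local Notation nrm := (@padic_norm R p p_pr).

Lemma padic_norm_nat (m : nat) : (0 < m)%N -> nrm m%:R = p%:R ^- logn p m.
Proof.
move=> m0; rewrite -(@ratr_nat Qp) padic_norm_ratr /padic_abs.
rewrite pnatr_eq0 eqn0Ngt m0 /= -[m%:R]/(m%:Z%:~R) numq_int denq_int.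
rewrite logn1 absz_nat sub0r -exprnN rmorphV ?rmorphXn ?rmorph_nat//.
by rewrite unitfE expf_neq0 // pnatr_eq0 -lt0n prime_gt0.
Qed.

Lemma padic_normN x : nrm (- x) = nrm x.
Proof.
rewrite -mulN1r padic_normM -[RHS]mul1r; congr (_ * _).
have -> : -1 = ratr (-1) :> Qp by rewrite -[-1 in RHS]/((-1)%:~R) ratr_int.
by rewrite padic_norm_ratr padic_absN padic_abs1 rmorph1.
Qed.

Lemma padic_normP : is_padic_norm p nrm.
Proof.
split; [exact: padic_norm_eq0 | exact: padic_normM | exact: padic_normD | exact: padic_normN | exact: padic_norm_nat].
Qed.

Local Notation pdvd := (pdvd p nrm).
Local Notation P := padic_normP.

(** By density x is replaced by a rational r, still integral; its denominator is prime to p, and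
    Bezout inverts it modulo p^L. *)
Lemma padic_has_residues : has_residues p nrm.
Proof.
move=> L x x0; have p_gt0 : 0 < p%:R :> R by rewrite ltr0n prime_gt0.
have e0 : 0 < p%:R ^ (- (L : int)) :> R by rewrite exprz_gt0.
have [r /ltW xr] := padic_dense x e0.
have r0 : pdvd 0 (ratr r).
  rewrite -[ratr r](subKr x); apply: (pdvdB P) => //.
  exact: (@pdvd_le R p p_pr _ nrm 0 L).
have d0 : (denq r)%:~R != 0 :> Qp by rewrite (int_neq0F p_pr P) ?denq_eq0.
have rE : ratr r * (denq r)%:~R = (numq r)%:~R :> Qp by rewrite /ratr divfK.
(* If p divided the denominator, integrality of r would make it divide the numerator as well. *)
have co : coprime p `|denq r|.
  rewrite prime_coprime //; apply/negP => pd.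
  have : pdvd 1 ((numq r)%:~R : Qp).
    by rewrite -rE; apply: (pdvdMl p_pr P) => //;
      rewrite -[1]/(1%N : int) (pdvd_int p_pr P) expn1.
  rewrite -[1]/(1%N : int) (pdvd_int p_pr P) expn1 => pn.
  have := dvdn_gcd p `|numq r| `|denq r|; rewrite pn pd.
  have := coprime_num_den r; rewrite /coprime => /eqP ->; rewrite dvdn1 /=.
  by move=> p1; have := prime_gt1 p_pr; rewrite (eqP (p1 : p == 1%N)).
have [u v uv _] := egcdzP (p ^ L)%N (denq r).
have g1 : gcdz (p ^ L)%N (denq r) = 1.
  by apply/eqP; have := coprimeXl L co; rewrite /coprime /gcdz absz_nat => /eqP ->.
rewrite g1 in uv.
pose w := (numq r * v)%R.
have q0 : (p ^ L)%N%:Z != 0 by rewrite eqz_nat -lt0n expn_gt0 prime_gt0.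
exists `|(w %% (p ^ L)%N)%Z|%N.
  by rewrite -ltz_nat gez0_abs ?modz_ge0 // ltz_pmod // ltz_nat expn_gt0 prime_gt0.
apply: (pdvd_trans P xr).
rewrite -[X in _ - X]/(`|(w %% (p ^ L)%N)%Z|%N%:Z%:~R) gez0_abs ?modz_ge0 //.
have dint : pdvd 0 ((denq r)%:~R^-1 : Qp).
  rewrite /pdvd (pnormV P) oppr0 expr0z (pnorm_int P) ?denq_eq0 //.
  by rewrite lognE -(negbK (_ %| _)%N) -prime_coprime // co !andbF expr0 !invr1.
have -> : ratr r - (w %% (p ^ L)%N)%Z%:~R = (numq r - (w %% (p ^ L)%N)%Z *
  denq r)%:~R / (denq r)%:~R :> Qp.
  by rewrite intrB intrM -rE -mulrBl mulfK.
apply: (pdvdMr p_pr P) => //; rewrite (pdvd_int p_pr P).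
have : (((p ^ L)%N%:Z %| numq r - (w %% (p ^ L)%N)%Z * denq r)%Z).
  apply/dvdzP; exists (numq r * u + (w %/ (p ^ L)%N)%Z * denq r).
  rewrite -[X in X - _ = _]mulr1 -uv.
  have -> : (w %% (p ^ L)%N)%Z = w - (w %/ (p ^ L)%N)%Z * (p ^ L)%N%:Z.
    by rewrite {2}(divz_eq w (p ^ L)%N) addrC addKr.
  by rewrite /w; ring.
by rewrite dvdzE.
Qed.

End PadicInstance.

(** * Counting residues of polynomial values *)

Lemma shift_poly (F : comNzRingType) (d : nat) (w : nat -> F) (s u t : F) :
  \sum_(j < d.+1) w j * (s + u * t) ^+ j =
  \sum_(m < d.+1) t ^+ m *
    \sum_(j < d.+1) w j * ('C(j, m)%:R * (s ^+ (j - m) * u ^+ m)).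
Proof.
under [RHS]eq_bigr do rewrite big_distrr.
rewrite exchange_big /=; apply: eq_bigr => j _.
have jd : (j.+1 <= d.+1)%N by [].
rewrite exprDn (big_ord_widen _ (fun m => (s ^+ (j - m) * (u * t) ^+ m) *+ 'C(j, m))
  jd).
rewrite big_mkcond big_distrr; apply: eq_bigr => m _ /=.
case: ltnP => jm; first by rewrite exprMn -mulr_natl; ring.
by rewrite bin_small // mul0r !mulr0.
Qed.

Section ImageBound.
Variables (R : realType) (p : nat) (p_pr : prime p).
Variables (F : fieldType) (nrm : F -> R).
Hypothesis nrmP : is_padic_norm p nrm.
Hypothesis nrm_res : has_residues p nrm.
Local Notation pdvd := (pdvd p nrm).
Variables (L : nat) (D : finType) (d : D -> nat) (V : Type) (E : set V).
Variable w : V -> D -> nat -> F.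

Definition poly_val v (r : F) l := \sum_(j < (d l).+1) w v l j * r ^+ j.

Definition val_res (r : F) v : {ffun D -> 'I_(p ^ L)} :=
  [ffun l => padic_res p_pr nrm L (poly_val v r l)].

Definition res_image (r : F) : {set {ffun D -> 'I_(p ^ L)}} :=
  [set z | `[< exists2 v, E v & val_res r v = z >]].

Lemma res_imageP r z : reflect (exists2 v, E v & val_res r v = z) (z \in res_image r).
Proof. by rewrite inE; exact: asboolP. Qed.

Lemma val_res_eqP r v v' : (forall l, pdvd 0 (poly_val v r l)) ->
  (forall l, pdvd 0 (poly_val v' r l)) ->
  val_res r v = val_res r v' <->
  forall l, pdvd L (poly_val v r l - poly_val v' r l).
Proof.
move=> v_int v'_int; split=> [/ffunP H l|H].
  by apply/(eq_padic_res p_pr nrmP nrm_res) => //; have := H l; rewrite !ffunE.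
by apply/ffunP => l; rewrite !ffunE; apply/(eq_padic_res p_pr nrmP nrm_res).
Qed.

Variables (s u : F).
(** The Taylor coefficients in t of the value at s + u t; their integrality is assumed here and
    arranged later by rescaling. *)
Let sc v l m := \sum_(j < (d l).+1) w v l j * ('C(j, m)%:R * (s ^+ (j - m) * u ^+ m)).
Hypothesis sc_int : forall v l m, E v -> pdvd 0 (sc v l m).

Let valE v l t : poly_val v (s + u * t) l = \sum_(m < (d l).+1) t ^+ m * sc v l m.
Proof. exact: shift_poly. Qed.

Lemma poly_val_int v l t : E v -> pdvd 0 t -> pdvd 0 (poly_val v (s + u * t) l).
Proof.
move=> Ev t0; rewrite valE; apply: (pdvd_sum nrmP) => m _.
by apply: (pdvdMl p_pr nrmP); [exact: (pdvdX p_pr nrmP)|exact: sc_int].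
Qed.

Lemma poly_val_congr v l t t' : E v -> pdvd 0 t -> pdvd 0 t' -> pdvd L (t - t') ->
  pdvd L (poly_val v (s + u * t) l - poly_val v (s + u * t') l).
Proof.
move=> Ev t0 t'0 tt'; rewrite !valE -sumrB; apply: (pdvd_sum nrmP) => m _.
rewrite -mulrBl; apply: (pdvdMr p_pr nrmP); last exact: sc_int.
rewrite subrXX; apply: (pdvdMr p_pr nrmP) => //; apply: (pdvd_sum nrmP) => i _.
by apply: (pdvdMl p_pr nrmP); exact: (pdvdX p_pr nrmP).
Qed.

Lemma res_image_congr t t' : pdvd 0 t -> pdvd 0 t' -> pdvd L (t - t') ->
  res_image (s + u * t) = res_image (s + u * t').
Proof.
move=> t0 t'0 tt'.
have E1 v : E v -> val_res (s + u * t) v = val_res (s + u * t') v.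
  move=> Ev; apply/ffunP => l; rewrite !ffunE; apply/(eq_padic_res p_pr nrmP nrm_res).
  - exact: poly_val_int.
  - exact: poly_val_int.
  - exact: poly_val_congr.
apply/setP => z; apply/res_imageP/res_imageP => -[v Ev <-]; exists v => //.
  by rewrite E1.
by rewrite E1.
Qed.

(** One member is chosen per residue vector at s. The constant Taylor coefficients are the values at
    s, hence distinct modulo p^L, as [polynomials_bound] requires. *)
Lemma res_image_bound (G : {set 'I_(p ^ L)}) (N : nat) :
  (0 < #|D|)%N -> (0 < L)%N ->
  (forall t : 'I_(p ^ L), t \in G -> (#|res_image (s + u * t%:R)| <= N)%N) ->
  (N < #|res_image s|)%N ->
  (#|res_image s| * #|G| ^ (\sum_l maxn 1 (d l)) <=
   2 * (4 * (\sum_l maxn 1 (d l)) * L * p ^ L) ^ (\sum_l maxn 1 (d l)) * N)%N.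
Proof.
move=> D0 L0 GN Ns; pose I := {z | z \in res_image s}.
have [v vP] : exists v : I -> V, forall i, E (v i) /\ val_res s (v i) = val i.
  have vP (i : I) : exists v, E v /\ val_res s v = val i.
    by have [v Ev vi] := res_imageP _ _ (valP i); exists v.
  by exists (fun i => projT1 (cid (vP i))) => i; case: cid.
have nat_int (m : nat) : pdvd 0 (m%:R : F) := pdvd_nat0 p_pr nrmP m.
have valE0 v' l : poly_val v' s l = sc v' l 0.
  rewrite -[s in LHS]addr0 -[in LHS](mulr0 u) valE big_ord_recl expr0 mul1r.
  by rewrite big1 ?addr0 // => m _; rewrite expr0n mul0r.
have := @polynomials_bound R p p_pr F nrm nrmP nrm_res L I D _ d (fun i => sc (v i))
  (fun t i => val_res (s + u * t%:R) (v i)) G N _ _ _ _ _ D0 L0.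
rewrite card_sig => H; apply: leq_trans (H _ _ _ _ _).
- apply: eq_leq; congr (_ * _)%N; apply: eq_card => z; by rewrite !inE.
- by move=> i l j; apply: sc_int; case: (vP i).
- move=> i i' H'; apply: val_inj; have [Ei <-] := vP i; have [Ei' <-] := vP i'.
  apply/ffunP => l; rewrite !ffunE; apply/(eq_padic_res p_pr nrmP nrm_res);
    rewrite ?valE0 //; exact: sc_int.
- move=> t tG i i' /ffunP yE l; have [Ei _] := vP i; have [Ei' _] := vP i'.
  rewrite -!valE; apply/(eq_padic_res p_pr nrmP nrm_res).
  - exact: poly_val_int.
  - exact: poly_val_int.
  - by have := yE l; rewrite !ffunE.
(* t = 0 is the base point s, whose image has more than N elements. *)
- move=> t tG; rewrite lt0n; apply/negP => /eqP t0.
  by have := GN _ tG; rewrite t0 mulr0 addr0 leqNgt Ns.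
- move=> t tG; apply: leq_trans (GN _ tG); apply: subset_leq_card.
  apply/fintype.subsetP => _ /imsetP[i _ ->]; apply/res_imageP.
  by exists (v i) => //; case: (vP i).
Qed.

End ImageBound.

Lemma exists_expn_ge (R : realType) (p : nat) (x : R) : (1 < p)%N ->
  exists e : nat, x <= p%:R ^+ e.
Proof.
move=> p1; exists (Num.trunc x).+1.
apply: le_trans (ltW (truncnS_gt x)) _.
by rewrite -natrX ler_nat ltnW // ltn_expl.
Qed.

(** * Value group, balls and sizes of Taylor coefficients *)

Section NormValues.
Variables (R : realType) (p : nat) (p_pr : prime p).
Variables (F : fieldType) (nrm : F -> R).
Hypothesis nrmP : is_padic_norm p nrm.
Hypothesis nrm_res : has_residues p nrm.
Local Notation pdvd := (pdvd p nrm).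

Let p_gt0 : 0 < p%:R :> R. Proof. by rewrite ltr0n prime_gt0. Qed.
Let p_gt1 : 1 < p%:R :> R. Proof. by rewrite ltr1n prime_gt1. Qed.

(** After scaling into the integers, x is approximated by a natural number more closely than its own
    norm; the ultrametric inequality then makes both norms equal. *)
Lemma pnorm_value (x : F) : x != 0 -> exists v : int, nrm x = p%:R ^ v.
Proof.
move=> x0; have nx : 0 < nrm x by rewrite lt_neqAle eq_sym (pnorm_eq0 nrmP)
  x0 (pnorm_ge0 nrmP).
have [e xe] := exists_expn_ge (nrm x) (prime_gt1 p_pr).
pose z := p%:R ^ (e : int) * x.
have z_int : pdvd 0 z by rewrite (pdvd_pM p_pr nrmP) /pdvd sub0r opprK -exprnP.
have zn : nrm z = p%:R ^ (- (e : int)) * nrm x.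
  by rewrite (pnormM nrmP) (pnormXz nrmP) (pnorm_p p_pr nrmP) exprz_inv.
have nz : 0 < nrm z by rewrite zn mulr_gt0 // exprz_gt0.
have [L zL] := exists_expn_ge (nrm z)^-1 (prime_gt1 p_pr).
have [m _ zm] := nrm_res L.+1 z_int.
have {}zm : nrm (z - m%:R) < nrm z.
  apply: le_lt_trans zm _; rewrite -exprnN; apply: lt_le_trans (_ : p%:R ^- L <= _).
    by rewrite ltf_pV2 ?posrE ?exprn_gt0 // ltr_eXn2l.
  by rewrite -[leRHS]invrK lef_pV2 ?posrE ?exprn_gt0 ?invr_gt0.
have E : nrm m%:R = nrm z.
  apply/eqP; rewrite eq_le; apply/andP; split.
    rewrite -[m%:R](subKr z); apply: le_trans (pnormB nrmP _ _) _.
    by rewrite ge_max lexx ltW.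
  have := pnormD nrmP (z - m%:R) m%:R; rewrite subrK le_max => /orP[|//].
  by rewrite leNgt zm.
have m0 : (0 < m)%N.
  by rewrite lt0n; apply/eqP => m0; move: nz; rewrite -E m0 (pnorm0 nrmP) ltxx.
exists ((e : int) - (logn p m : int)).
have := E; rewrite (pnorm_nat nrmP) // zn => E'.
by rewrite expfzDr ?gt_eqF // -exprnN E' mulrA -expfzDr ?gt_eqF // subrr expr0z mul1r.
Qed.

(** Norms are powers of p, so rho can be lowered to the largest power of p not above it; that power
    is p^-b. *)
Lemma ball_exponent (rho : R) : 0 < rho ->
  exists b : int, forall x : F, (nrm x <= rho) = pdvd b x.
Proof.
move=> rho0.
have [e re] := exists_expn_ge rho (prime_gt1 p_pr).
have [e' re'] := exists_expn_ge rho^-1 (prime_gt1 p_pr).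
(* The shift by [e'] starts the search at a power not exceeding rho. *)
pose P (j : nat) := rho < p%:R ^ ((j : int) - (e' : int)).
have exP : exists j, P j.
  exists (e + e').+1; rewrite /P; apply: le_lt_trans re _; rewrite exprnP ltr_eXz2l //.
  by lia.
have notP0 : ~~ P 0%N.
  rewrite /P -leNgt sub0r -exprnN -[leRHS]invrK lef_pV2 ?posrE ?exprn_gt0 ?invr_gt0 //.
case: (ex_minnP exP) => [[|j]] Pj minj; first by rewrite Pj in notP0.
have Pj' : p%:R ^ ((j : int) - (e' : int)) <= rho.
  by rewrite leNgt; apply/negP => /minj; rewrite ltnn.
exists ((e' : int) - (j : int)) => x; rewrite /pdvd opprB; apply/idP/idP => h;
  last exact: le_trans h Pj'.
have [->|x0] := eqVneq x 0; first by rewrite (pnorm0 nrmP) exprz_ge0 // ltW.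
have [v vE] := pnorm_value x0; rewrite vE in h *.
have := le_lt_trans h Pj; rewrite ltr_eXz2l // => vj.
by rewrite ler_eXz2l //; lia.
Qed.

Lemma pdvd_ball_neg (x : F) (e : nat) : nrm x <= p%:R ^+ e -> pdvd (- (e : int)) x.
Proof. by rewrite /pdvd opprK exprnP. Qed.

Lemma pdvdX_neg (x : F) (e j : nat) : pdvd (- (e : int)) x -> pdvd (- ((e *
  j)%N : int)) (x ^+ j).
Proof.
move=> xe; elim: j => [|j IH];
  first by rewrite muln0 oppr0 expr0 (pdvd_nat0 p_pr nrmP 1).
by rewrite mulnS PoszD opprD exprS (pdvdM p_pr nrmP).
Qed.

(** A term multiplies an integer by one coefficient and j <= d factors s or u, each of norm at most
    p^e. *)
Lemma shift_coef_int (e d : nat) (w : nat -> F) (s u : F) (m : nat) :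
  (forall j, (j <= d)%N -> pdvd (- (e : int)) (w j)) ->
  pdvd (- (e : int)) s -> pdvd (- (e : int)) u ->
  pdvd (- ((e * d.+1)%N : int))
    (\sum_(j < d.+1) w j * ('C(j, m)%:R * (s ^+ (j - m) * u ^+ m))).
Proof.
move=> we se ue; apply: (pdvd_sum nrmP) => j _; have jd : (j <= d)%N by rewrite -ltnS.
have [jm|mj] := ltnP j m; first by rewrite bin_small // mul0r mulr0 (pdvd0 nrmP).
apply: (@pdvd_le R p p_pr F nrm _ (- (e : int) + (0 + (- ((e * (j - m))%N : int) +
  - ((e * m)%N : int))))).
  have : (e * j <= e * d)%N by rewrite leq_mul2l jd orbT.
  by rewrite mulnS mulnBr; have : (e * m <= e * j)%N; [rewrite leq_mul2l mj orbT|]; lia.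
apply: (pdvdM p_pr nrmP); first exact: we.
apply: (pdvdM p_pr nrmP); first exact: (pdvd_nat0 p_pr nrmP).
by apply: (pdvdM p_pr nrmP); exact: pdvdX_neg.
Qed.

End NormValues.

(** A root of order [Lam] is taken after bounding 2 eta by (2 eta^(1/Lam))^Lam, which turns the
    constant 4 into 8. *)
Lemma root_bound (R : realType) (K q L N M Lam : nat) (eta : R) :
  (0 < Lam)%N -> (0 < q)%N -> (0 < M)%N -> 0 < eta -> N%:R <= eta * M%:R ->
  (M * K ^ Lam <= 2 * (4 * Lam * L * q) ^ Lam * N)%N ->
  K%:R / q%:R <= 8 * Lam%:R * L%:R * eta `^ (1 / Lam%:R) :> R.
Proof.
move=> Lam0 q0 M0 eta0 NM H.
have {}H : (K%:R / q%:R) ^+ Lam <= (4 * Lam%:R * L%:R) ^+ Lam * (2 * eta) :> R.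
  have M0' : 0 < M%:R :> R by rewrite ltr0n.
  have q0' : 0 < q%:R ^+ Lam :> R by rewrite exprn_gt0 // ltr0n.
  rewrite expr_div_n ler_pdivrMr // -(ler_pM2l M0').
  have := H; rewrite -(ler_nat R) !natrM !natrX !natrM => /le_trans; apply.
  rewrite [in leLHS]exprMn.
  have -> : M%:R * ((4 * Lam%:R * L%:R) ^+ Lam * (2 * eta) * q%:R ^+ Lam) =
    2 * ((4 * Lam%:R * L%:R) ^+ Lam * q%:R ^+ Lam) * (eta * M%:R) :> R by ring.
  by apply: ler_wpM2l => //; rewrite !mulr_ge0 ?exprn_ge0 ?mulr_ge0.
have Lam0' : Lam%:R != 0 :> R by rewrite pnatr_eq0 -lt0n.
set e := eta `^ _; have eE : eta = e ^+ Lam.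
  by rewrite /e -powR_mulrn ?powR_ge0 // -powRrM div1r mulVf // powRr1 // ltW.
have e0 : 0 <= e by exact: powR_ge0.
rewrite -(ler_pXn2r Lam0) ?nnegrE ?divr_ge0 ?mulr_ge0 //.
apply: le_trans H _; rewrite eE.
have -> : 8 * Lam%:R * L%:R * e = (4 * Lam%:R * L%:R) * (2 * e) by ring.
rewrite [leRHS]exprMn; apply: ler_wpM2l; first by rewrite exprn_ge0 ?mulr_ge0.
rewrite [leRHS]exprMn; apply: ler_wpM2r; first by rewrite exprn_ge0.
by apply: ler_eXnr; rewrite ?ler1n.
Qed.

(** * Haar measure of residue classes *)

Lemma counting_image (T : choiceType) (W : finType) (R : realType) (S : {set W})
    (f : W -> T) (A : set T) :
  {in S &, injective f} -> (forall x, A x <-> exists2 z, z \in S & f z = x) ->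
  counting A = (#|S|%:R%:E : \bar R).
Proof.
move=> f_inj AP; have [S0|S_gt0] := posnP #|S|.
  have -> : A = set0.
    by rewrite -subset0 => x /AP[z zS _]; have := card_gt0P; move: zS;
      rewrite (card0_eq S0).
  rewrite /counting; case: asboolP => [_|[]]; last exact: finite_set0.
  by rewrite fset_set0 S0.
have [z0 z0S] : exists z, z \in S by apply/card_gt0P.
have AE : A = [set f (nth z0 (enum S) m) | m in `I_#|S|]%classic.
  apply/seteqP; split=> x.
    move=> /AP[z zS <-]; exists (index z (enum S)); last by rewrite nth_index ?mem_enum.
    by rewrite /= cardE index_mem mem_enum.
  move=> [m /= mS <-]; apply/AP; exists (nth z0 (enum S) m) => //.
  by rewrite -mem_enum mem_nth // -cardE.
have A_card : (A #= `I_#|S|)%card.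
  rewrite AE; apply: inj_card_eq => m m'; rewrite !inE /= => mS m'S E.
  apply/eqP; rewrite -(nth_uniq z0 (s := enum S)) ?enum_uniq -?cardE //; apply/eqP.
  by apply: f_inj => //; rewrite -mem_enum mem_nth // -cardE.
rewrite /counting; case: asboolP => [_|[]]; first by rewrite (card_fset_set A_card).
by exists #|S|.
Qed.

Lemma addrBK (V : zmodType) (z x : V) : z + (x - z) = x.
Proof. by rewrite addrC subrK. Qed.

Lemma addrKB (V : zmodType) (z x : V) : z + x - z = x.
Proof. by rewrite addrAC subrr add0r. Qed.

Lemma affine_sub (V : comNzRingType) (x s u a b : V) :
  x - (s + u * b) - (x - (s + u * a)) = u * (a - b).
Proof. by ring. Qed.

Lemma affine_inv (V : fieldType) (x s t u : V) : u != 0 ->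
  x - (s + u * t) = u * (u^-1 * (x - s) - t).
Proof. by move=> u0; rewrite mulrBr mulVKf // opprD addrA. Qed.

Lemma affine_split (V : zmodType) (x s w : V) : x - s = x - (s + w) + w.
Proof. by rewrite opprD addrA subrK. Qed.

Section Haar.
Variables (R : realType) (p : nat) (p_pr : prime p).
Local Notation Qp := (padic p_pr).
Local Notation nrm := (@padic_norm R p p_pr).
Local Notation pdvd := (pdvd p nrm).
Let nrmP : is_padic_norm p nrm := padic_normP R p_pr.
Let nrm_res : has_residues p nrm := @padic_has_residues R p p_pr.
Implicit Types (b : int).
Variable mu : {measure set (padic_borel R p_pr) -> \bar R}.
Hypothesis mu_haar : is_haar mu.

Definition pball (b : int) (z : Qp) : set (padic_borel R p_pr) :=
  [set x : Qp | pdvd b (x - z)]%classic.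

Lemma measurable_pball b z : measurable (pball b z).
Proof.
apply: sub_sigma_algebra => x /= xz; exists (p%:R ^ (- b)).
  by rewrite exprz_gt0 // ltr0n prime_gt0.
move=> y yx; rewrite /pball /=; apply: (pdvd_trans nrmP) xz.
exact: ltW.
Qed.

Lemma pball0 b x : pball b 0 x <-> pdvd b x.
Proof. by rewrite /pball /= (subr0 (x : Qp)). Qed.

Lemma pball_transl b z : mu (pball b z) = mu (pball b 0).
Proof.
rewrite -[RHS](mu_haar.1 z) ?measurable_pball //; last exact: measurable_pball.
congr (mu _); apply/seteqP; split=> x.
  move=> xz; exists ((x : Qp) - z); last exact: (addrBK (z : Qp) x).
  by apply/pball0.
move=> [y yb <-]; have y0 := (pball0 b y).1 yb.
by rewrite /pball /= (addrKB (z : Qp) y).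
Qed.

Lemma pball_disjoint b (L : nat) (s : Qp) (t t' : 'I_(p ^ L)) x :
  pball (b + L) (s + p%:R ^ b * t%:R) x -> pball (b + L) (s + p%:R ^ b * t'%:R) x ->
    t = t'.
Proof.
rewrite /pball /= => xt xt'; apply: ord_inj; apply/eqP.
rewrite -(modn_small (ltn_ord t)) -[X in _ == X](modn_small (ltn_ord t')).
rewrite -(pdvd_nat_sub p_pr nrmP).
have := pdvdB nrmP xt' xt; rewrite affine_sub (pdvd_pM p_pr nrmP).
by rewrite (_ : b + L - b = L) // addrAC subrr add0r.
Qed.

Lemma mu_pball_union b (L : nat) (s : Qp) (G : {set 'I_(p ^ L)}) (r : R) :
  mu (pball (b + L) 0) = r%:E ->
  mu (\bigcup_(t in [set t | t \in G]) pball (b + L) (s + p%:R ^ b * t%:R))%classic =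
    (#|G|%:R * r)%:E.
Proof.
move=> mur; have finG : finite_set [set t | t \in G]%classic.
  by exact: finite_finset.
rewrite measure_fin_bigcup //; last 2 first.
- by move=> t t' _ _ [x [xt xt']]; exact: pball_disjoint xt xt'.
- by move=> t _; exact: measurable_pball.
rewrite fsbig_finite //= (eq_bigr (fun=> r%:E)) => [|t _]; last by rewrite pball_transl.
rewrite sumEFin big_const_seq iter_addr_0 count_predT mulr_natl.
congr ((_ *+ _)%:E).
rewrite cardE; apply: perm_size; apply: uniq_perm;
  rewrite ?finmap.fset_uniq ?enum_uniq // => t.
by rewrite in_fset_set // mem_enum; apply/idP/idP => [/set_mem|/mem_set].
Qed.

Lemma pball_split b (L : nat) (s : Qp) : pball b s =
  (\bigcup_(t in [set t | t \in [set: 'I_(p ^ L)]%SET]) pball (b + L) (s + p%:R ^ b *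
    t%:R))%classic.
Proof.
have p0 : p%:R ^ b != 0 :> Qp by rewrite expfz_neq0 // (p_neq0F p_pr nrmP).
have bL : b + L - b = L by rewrite addrAC subrr add0r.
apply/seteqP; split=> x; rewrite /pball /=.
  move=> xs; have x_int : pdvd 0 ((p%:R ^ b)^-1 * ((x : Qp) - s)).
    by rewrite -(subrr b) -(pdvd_pM p_pr nrmP) mulVKf.
  exists (padic_res p_pr nrm L ((p%:R ^ b)^-1 * ((x : Qp) - s)));
    first by rewrite /= inE.
  rewrite /= (affine_inv (x : Qp) s _ p0) (pdvd_pM p_pr nrmP) bL.
  exact: (padic_resP p_pr nrmP nrm_res).
move=> [t _ /=] xt; rewrite (affine_split (x : Qp) s (p%:R ^ b * t%:R)).
apply: (pdvdD nrmP); first by apply: (pdvd_le p_pr) xt; rewrite lerDl.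
by rewrite (pdvd_pM p_pr nrmP) subrr (pdvd_nat0 p_pr nrmP).
Qed.

(** For b >= 0, Z_p is a disjoint union of p^b translates of the ball; for b < 0 the ball is one of
    p^-b translates of Z_p. *)
Lemma mu_pball b z : mu (pball b z) = (p%:R ^ (- b))%:E.
Proof.
have p0 : p%:R != 0 :> R by rewrite pnatr_eq0 -lt0n prime_gt0.
rewrite pball_transl.
have mu0 : mu (pball 0 0) = 1%E.
  rewrite -mu_haar.2; congr (mu _); apply/seteqP; split=> x;
  by rewrite /pball /padic_int /= subr0 /pdvd oppr0 expr0z.
have split_eq (c : int) (L : nat) (r : R) : mu (pball (c + L) 0) = r%:E ->
    mu (pball c 0) = (p%:R ^+ L * r)%:E.
  move=> mur; rewrite (pball_split c L) (mu_pball_union _ _ mur).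
  by rewrite cardsT card_ord natrX.
case: b => L.
  (* Inclusion in Z_p gives finiteness, so the splitting identity can be solved for this measure in
     the reals. *)
  have fin : mu (pball L 0) \is a fin_num.
    rewrite ge0_fin_numE ?measure_ge0 //; apply: le_lt_trans (ltry 1).
    rewrite -mu0; apply: le_measure; rewrite ?inE; try exact: measurable_pball.
    by move=> x; rewrite /pball /=; apply: (pdvd_le p_pr).
  have := split_eq 0 L (fine (mu (pball L 0))); rewrite add0r fineK // => /(_ erefl).
  rewrite mu0 => -[E]; rewrite -(fineK fin); congr (_%:E).
  by rewrite -exprnN; apply: (mulfI (expf_neq0 L p0)); rewrite -E divff // expf_neq0.
have := split_eq (Negz L) L.+1 1; rewrite NegzE addNr => /(_ mu0) ->.
by rewrite mulr1 opprK exprnP.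
Qed.

Lemma normalized_union b (L : nat) (s : Qp) (G : {set 'I_(p ^ L)}) (A : set Qp) :
  A = (\bigcup_(t in [set t | t \in G]) pball (b + L) (s + p%:R ^ b * t%:R))%classic ->
  normalized mu (pball b s) A = (#|G|%:R / (p ^ L)%:R)%:E.
Proof.
move=> AE; rewrite /normalized; have -> : (A `&` pball b s = A)%classic.
  apply/setIidPl; rewrite AE (pball_split b L s) => x [t _ xt].
  by exists t; rewrite //= inE.
rewrite {}AE (mu_pball_union _ _ (mu_pball _ _)) mu_pball.
have p0 : p%:R != 0 :> R by rewrite pnatr_eq0 -lt0n prime_gt0.
rewrite inver expfz_eq0 (negbTE p0) andbF -EFinM; congr (_%:E).
rewrite opprD expfzDr // -mulrA; congr (_ * _).
by rewrite mulrAC divff ?expfz_neq0 // mul1r natrX exprnN.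
Qed.

End Haar.

(** * Covering numbers *)

Section Generic.
Variables (R : realType) (p : nat) (p_pr : prime p).
Variables (F : fieldType) (nrm : F -> R).
Hypothesis nrmP : is_padic_norm p nrm.
Local Notation pdvd := (pdvd p nrm).

Lemma scaled_int_rowP (m : int) (r : nat) (q : 'rV[F]_r) :
  (exists z : 'rV[F]_r, (forall l, nrm (z 0 l) <= 1) /\ q = p%:R ^ m *: z) <->
  (forall l, pdvd m (q 0 l)).
Proof.
have p0 := p_neq0F p_pr nrmP; split=> [[z [z_int ->]] l|q_int].
  by rewrite mxE (pdvd_pM p_pr nrmP) subrr /pdvd oppr0 expr0z.
exists (p%:R ^ (- m) *: q); split=> [l|].
  have : pdvd 0 (p%:R ^ (- m) * q 0 l) by rewrite (pdvd_pM p_pr nrmP) opprK add0r.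
  by rewrite mxE /pdvd oppr0 expr0z.
by rewrite scalerA -expfzDr // subrr expr0z scale1r.
Qed.

Lemma scaled_evalE (dd r : nat) (b x : F) (a : 'I_dd.+1 -> F) (v : 'I_dd.+1 ->
  'rV[F]_r) l :
  \sum_(j < dd.+1) (b * (a (inord j) * v (inord j) 0 l)) * x ^+ j =
  b * (\sum_(j < dd.+1) (a j * x ^+ j) *: v j) 0 l.
Proof.
rewrite summxE big_distrr /=; apply: eq_bigr => j _.
by rewrite mxE inord_val; ring.
Qed.

Lemma scale_sum_coef (dd : nat) (b : F) (w X : nat -> F) :
  \sum_(j < dd) (b * w j) * X j = b * \sum_(j < dd) w j * X j.
Proof. by rewrite big_distrr; apply: eq_bigr => j _ /=; rewrite mulrA. Qed.

End Generic.

Section Covering.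
Variables (R : realType) (p : nat) (p_pr : prime p).
Local Notation Qp := (padic p_pr).
Local Notation nrm := (@padic_norm R p p_pr).
Local Notation pdvd := (pdvd p nrm).
Let nrmP : is_padic_norm p nrm := padic_normP R p_pr.
Let nrm_res : has_residues p nrm := @padic_has_residues R p p_pr.
Variables (k : nat) (n d : 'I_k -> nat) (alpha : 'I_k -> R) (delta : R).
Variables (a : scalar_family p_pr d) (E : set (coef_space p_pr n d)).
Let D : finType := {i : 'I_k & 'I_(n i)}.
Let m i := scale_exp p alpha delta i.

Lemma aniso_boxP (q : padic_prod p_pr n) :
  aniso_box alpha delta q <-> forall i l, pdvd (m i) (q i 0 l).
Proof.
split=> H i; first by apply/(scaled_int_rowP p_pr nrmP); exact: H.
by apply/(scaled_int_rowP p_pr nrmP); exact: H.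
Qed.

Lemma mem_aniso_coset (x y : padic_prod p_pr n) :
  aniso_coset alpha delta x y <-> forall i l, pdvd (m i) (y i 0 l - x i 0 l).
Proof.
split=> [[q /aniso_boxP Hq <-] i l|H].
  by rewrite mxE addrAC subrr add0r.
exists (fun i => y i - x i); first by apply/aniso_boxP => i l; rewrite !mxE.
by apply: functional_extensionality_dep => i; rewrite addrC subrK.
Qed.

Lemma aniso_coset_eq (x y : padic_prod p_pr n) :
  aniso_coset alpha delta x = aniso_coset alpha delta y <->
  forall i l, pdvd (m i) (x i 0 l - y i 0 l).
Proof.
split=> [E1|H].
  apply/mem_aniso_coset; rewrite -E1; apply/mem_aniso_coset => i l.
  by rewrite subrr (pdvd0 nrmP).
apply/seteqP; split=> z /mem_aniso_coset zH; apply/mem_aniso_coset => i l.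
  exact: (pdvd_trans nrmP (zH i l)).
apply: (pdvd_trans nrmP (zH i l)); rewrite (pdvdC nrmP); exact: H.
Qed.

Variable L : nat.

(* The factor p^(L - m_i) turns cosets of p^(m_i) Z_p into residue classes mod p^L. *)
Definition scaled_coef (v : coef_space p_pr n d) (x : D) (j : nat) : Qp :=
  p%:R ^ ((L : int) - m (tag x)) *
    (a (inord j : 'I_(d (tag x)).+1) * v (tag x) (inord j) 0 (tagged x)).

Local Notation dD := (fun x : D => d (tag x)).
Local Notation img := (res_image p_pr nrm L dD E scaled_coef).

Lemma poly_val_scaled v r (x : D) : poly_val dD scaled_coef v r x =
  p%:R ^ ((L : int) - m (tag x)) * poly_eval a r v (tag x) 0 (tagged x).
Proof. exact: scaled_evalE. Qed.

Lemma val_res_eq v v' r :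
  (forall x, pdvd 0 (poly_val dD scaled_coef v r x)) ->
  (forall x, pdvd 0 (poly_val dD scaled_coef v' r x)) ->
  val_res p_pr nrm L dD scaled_coef r v = val_res p_pr nrm L dD scaled_coef r v' <->
  aniso_coset alpha delta (poly_eval a r v)
    = aniso_coset alpha delta (poly_eval a r v').
Proof.
move=> v_int v'_int.
have key x : pdvd L (poly_val dD scaled_coef v r x - poly_val dD scaled_coef v' r x) =
    pdvd (m (tag x)) (poly_eval a r v (tag x) 0 (tagged x) - poly_eval a r v' (tag x)
      0 (tagged x)).
  by rewrite !poly_val_scaled -mulrBr (pdvd_pM p_pr nrmP) subKr.
rewrite aniso_coset_eq (val_res_eqP p_pr nrmP nrm_res _ v_int v'_int).
split=> [H i l|H x]; last by rewrite key.
by have := H (existT _ i l : D); rewrite key.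
Qed.

(** A residue vector is sent to the coset of any value having it; by [val_res_eq] this is well
    defined and injective on the image, where the default [set0] is never reached. *)
Lemma covering_numberE r :
  (forall v x, E v -> pdvd 0 (poly_val dD scaled_coef v r x)) ->
  covering_number alpha delta (poly_eval a r @` E)%classic = (#|img r|%:R%:E : \bar R).
Proof.
move=> val_int; pose C (v : coef_space p_pr n d) :=
  aniso_coset alpha delta (poly_eval a r v).
pose rho := val_res p_pr nrm L dD scaled_coef r.
have rhoE v v' : E v -> E v' -> rho v = rho v' <-> C v = C v'.
  by move=> Ev Ev'; apply: val_res_eq => x; exact: val_int.
pose f z := if pselect (exists2 v, E v & rho v = z) is left h then
  C (projT1 (cid2 h)) else set0.
have fE v : E v -> f (rho v) = C v.
  rewrite /f => Ev; case: pselect => [h|[]]; last by exists v.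
  by case: cid2 => v' /= Ev' /(rhoE _ _ Ev' Ev).
apply: (@counting_image _ _ _ _ f) =>
  [z z' /res_imageP[v Ev <-] /res_imageP[v' Ev' <-]|X].
  exact: (fun H => (rhoE v v' Ev Ev').2 (etrans (esym (fE v Ev))
    (etrans H (fE v' Ev')))).
split=> [[[x ->] [y [xy [v Ev vy]]]]|[z zS <-]].
  exists (rho v); first by apply/res_imageP; exists v.
  apply: etrans (fE v Ev) _; apply/aniso_coset_eq; rewrite vy; exact/mem_aniso_coset.
have /res_imageP[v Ev vz] := zS.
have -> : f z = C v by apply: etrans (fE v Ev); rewrite -vz.
split; first by exists (poly_eval a r v).
exists (poly_eval a r v); split; last by exists v.
by apply/mem_aniso_coset => i l; rewrite subrr (pdvd0 nrmP).
Qed.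

End Covering.

Lemma padic_norm_le_coef_norm (R : realType) (p : nat) (p_pr : prime p) (k : nat)
    (n d : 'I_k -> nat) (b : coef_space p_pr n d) i j l : padic_norm R (b i j 0 l) <= coef_norm R b.
Proof.
rewrite /coef_norm; apply: le_trans (le_bigmax _ _ i).
by apply: le_trans (le_bigmax _ _ j); exact: le_bigmax.
Qed.

Lemma shift_inv (V : fieldType) (x s u : V) : u != 0 -> s + u * (u^-1 * (x - s)) = x.
Proof. by move=> u0; rewrite mulVKf // addrC subrK. Qed.

(** * Choice of the modulus, integrality and the sublevel estimate *)

Section Assembly.
Variables (R : realType) (p : nat) (p_pr : prime p).
Local Notation Qp := (padic p_pr).
Local Notation nrm := (@padic_norm R p p_pr).
Local Notation pdvd := (pdvd p nrm).
Let nrmP : is_padic_norm p nrm := padic_normP R p_pr.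
Let nrm_res : has_residues p nrm := @padic_has_residues R p p_pr.
Variables (k : nat) (k_gt0 : (0 < k)%N) (n d : 'I_k -> nat).
Hypothesis n_gt0 : forall i, (0 < n i)%N.
Variables (alpha : 'I_k -> R) (alpha_ge0 : forall i, 0 <= alpha i).
Variables (c : Qp) (rho bound : R) (e : nat) (b : int).
Hypothesis bE : forall x : Qp, (nrm x <= rho) = pdvd b x.
Hypothesis bound_e : bound <= p%:R ^+ e.
Hypothesis c_e : nrm c <= p%:R ^+ e.
Hypothesis rho_e : rho <= p%:R ^+ e.

Let D : finType := {i : 'I_k & 'I_(n i)}.
Local Notation dD := (fun x : D => d (tag x)).
Let Lam : nat := (\sum_(i < k) n i * maxn 1 (d i))%N.
(** p^R1 bounds the norms of all Taylor coefficients over the ball before rescaling. *)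
Let R1 := (e * (\max_(i < k) d i).+1)%N.
Let m delta i := scale_exp p alpha delta i.
(** Makes L - m_i >= R1 for every i, which gives integrality after rescaling; the final 1 keeps L
    positive. *)
Let modexp delta : nat := (R1 + \sum_(i < k) `|m delta i| + 1)%N.
Let u : Qp := p%:R ^ b.

Let p_gt1 : 1 < p%:R :> R. Proof. by rewrite ltr1n prime_gt1. Qed.

Lemma sum_D : (\sum_(x : D) maxn 1 (d (tag x)) = Lam)%N.
Proof.
rewrite /Lam -(@sig_big_dep _ _ _ _ _ xpredT (fun _ => xpredT) (fun i _ =>
  maxn 1 (d i))) /=.
by apply: eq_bigr => i _; rewrite sum_nat_const card_ord.
Qed.

Lemma card_D_gt0 : (0 < #|D|)%N.
Proof. by apply/card_gt0P; exists (existT _ (Ordinal k_gt0)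
  (Ordinal (n_gt0 (Ordinal k_gt0))) : D). Qed.

Lemma Lam_gt0 : (0 < Lam)%N.
Proof.
rewrite -sum_D; have /card_gt0P[x _] := card_D_gt0.
by rewrite (bigD1 x) //= addn_gt0 leq_max.
Qed.

Lemma scale_exp_ge0 delta i : 0 < delta < 1 -> 0 <= m delta i.
Proof.
move=> /andP[d0 d1]; rewrite /m /scale_exp ceil_ge0.
apply: (lt_le_trans (ltrN10 _)); rewrite mulr_ge0 // divr_ge0 ?ln_ge0 ?(ltW p_gt1) //.
by rewrite invf_ge1 // ltW.
Qed.

Lemma scale_exp_le (l : nat) i : m (p%:R ^- l) i <= Num.ceil (alpha i * l%:R).
Proof.
have lnp : ln p%:R != 0 :> R by rewrite gt_eqF // ln_gt0.
rewrite /m /scale_exp invrK lnXn ?(lt_trans ltr01 p_gt1) //.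
by rewrite -[ln p%:R *+ l]mulr_natr [_ * l%:R / _]mulrAC divff // mul1r.
Qed.

Lemma inv_expn_itv (l : nat) : (1 <= l)%N -> 0 < (p%:R ^- l : R) < 1.
Proof.
by move=> l1; rewrite invr_gt0 exprn_gt0 ?(lt_trans ltr01 p_gt1)
  //= invf_lt1 ?exprn_gt0 ?(lt_trans ltr01 p_gt1) // exprn_egt1 // -lt0n.
Qed.

(** Each m_i is at most alpha_i l + 1, so L is linear in l; the k ceilings account for the summand
    k. *)
Lemma modexp_le (l : nat) : (1 <= l)%N ->
  (modexp (p%:R ^- l))%:R <= (R1%:R + k%:R + \sum_i alpha i + 1) * (1 + l%:R) :> R.
Proof.
move=> l1; have l0 : 0 <= l%:R :> R by [].
have dl := inv_expn_itv l1.
have mle i : `|m (p%:R ^- l) i|%N%:R <= alpha i * l%:R + 1 :> R.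
  rewrite natr_absz ger0_norm ?scale_exp_ge0 //.
  apply: le_trans (_ : (Num.ceil (alpha i * l%:R))%:~R <= _);
    first by rewrite ler_int scale_exp_le.
  by rewrite -lerBlDr; have := ceil_itv (alpha i * l%:R);
    rewrite intrD rmorphN1 => /andP[/ltW].
rewrite /modexp !natrD natr_sum.
have S : \sum_(i < k) `|m (p%:R ^- l) i|%N%:R <= (\sum_i alpha i) * l%:R + k%:R :> R.
  apply: le_trans (ler_sum _ (fun i _ => mle i)) _.
  by rewrite big_split /= -big_distrl /= sumr_const card_ord.
have A0 : 0 <= \sum_i alpha i by exact: sumr_ge0.
have R0 : 0 <= R1%:R :> R by [].
have k0 : 0 <= k%:R :> R by [].
nra.
Qed.

Section Family.
Variables (a : scalar_family p_pr d) (E : set (coef_space p_pr n d)).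
Hypothesis E0 : (E !=set0)%classic.
Hypothesis E_bound : forall w, absorbed a E w -> coef_norm R w <= bound.
Variable delta : R.
Hypothesis delta01 : 0 < delta < 1.
Let L := modexp delta.
Local Notation W := (scaled_coef alpha delta a L).
Local Notation img := (res_image p_pr nrm L dD E W).

Let p_gt0 : 0 < p%:R :> R. Proof. exact: lt_trans ltr01 p_gt1. Qed.
Local Notation pball := (@pball R p p_pr).

Lemma u_int : pdvd (- (e : int)) u.
Proof.
apply: pdvd_ball_neg; apply: le_trans rho_e; rewrite bE; exact: (pdvd_expz p_pr nrmP).
Qed.

Lemma ball_int s : padic_ball c rho s -> pdvd (- (e : int)) s.
Proof.
move=> sB; apply: pdvd_ball_neg; rewrite -(subrK c s).
apply: le_trans (pnormD nrmP _ _) _; rewrite ge_max c_e andbT.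
exact: le_trans sB rho_e.
Qed.

Lemma coef_int v (x : D) j : E v ->
  pdvd (- (e : int)) (a (inord j : 'I_(d (tag x)).+1) * v (tag x) (inord j)
    0 (tagged x)).
Proof.
move=> Ev; apply: pdvd_ball_neg; apply: le_trans bound_e.
pose w : coef_space p_pr n d := fun i j => a j *: v i j.
apply: (@le_trans _ _ (coef_norm R w)); last by apply: E_bound; exists v.
by have := padic_norm_le_coef_norm R w (inord j : 'I_(d (tag x)).+1) (tagged x);
  rewrite /w mxE.
Qed.

Lemma shifted_int s v (x : D) i : padic_ball c rho s -> E v ->
  pdvd 0 (\sum_(j < (d (tag x)).+1) W v x j * ('C(j, i)%:R * (s ^+ (j - i) * u ^+ i))).
Proof.
move=> sB Ev.
pose w j : Qp := a (inord j : 'I_(d (tag x)).+1) * v (tag x) (inord j) 0 (tagged x).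
pose X j : Qp := 'C(j, i)%:R * (s ^+ (j - i) * u ^+ i).
suff : pdvd 0 (p%:R ^ ((L : int) - m delta (tag x)) * \sum_(j < (d (tag x)).+1) w j *
  X j).
  by rewrite -(scale_sum_coef _ _ w X).
rewrite (pdvd_pM p_pr nrmP).
apply: (@pdvd_le R p p_pr _ nrm _ (- ((e * (d (tag x)).+1)%N : int))); last first.
  apply: (shift_coef_int p_pr nrmP); [by move=> j _;
    exact: coef_int | exact: ball_int | exact: u_int].
have m_le : ((`|m delta (tag x)| <= \sum_(i < k) `|m delta i|)%N).
  by rewrite (bigD1 (tag x)) //= leq_addr.
have d_le : (e * (d (tag x)).+1 <= R1)%N.
  by rewrite leq_mul2l ltnS orbC (leq_bigmax (tag x)).
have m0 := scale_exp_ge0 (tag x) delta01.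
rewrite -/(m delta (tag x)) /L /modexp; move: m_le d_le m0.
move: (\sum_(i < k) _)%N => S; move: (e * _)%N R1 (m _ _) => A B M; clear; lia.
Qed.

Lemma covering_numberE_ball s : padic_ball c rho s ->
  covering_number alpha delta (poly_eval a s @` E)%classic = (#|img s|%:R%:E : \bar R).
Proof.
move=> sB; apply: covering_numberE => v x Ev.
have := poly_val_int p_pr nrmP (fun v l m => @shifted_int s v l m sB)
  x Ev (pdvd0 nrmP 0).
by rewrite mulr0 addr0.
Qed.

(** On the ball the covering numbers are cardinalities of sets of residue vectors, hence natural
    numbers with a common bound. *)
Lemma max_covering_attained : exists2 s, padic_ball c rho s &
  max_covering a alpha delta (padic_ball c rho) E = (#|img s|%:R%:E : \bar R).
Proof.
have cB : padic_ball c rho c by rewrite /padic_ball /= subrr bE (pdvd0 nrmP).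
pose P j := `[< exists2 s, padic_ball c rho s & #|img s| = j >].
have exP : exists j, P j by exists #|img c|; apply/asboolP; exists c.
have ubP j : P j -> (j <= #|{: {ffun D -> 'I_(p ^ L)}}|)%N.
  by move=> /asboolP[s _ <-]; exact: max_card.
case: (ex_maxnP exP ubP) => M /asboolP[s sB sM] maxM; exists s => //.
rewrite /max_covering; apply/eqP; rewrite eq_le; apply/andP; split.
  apply: ub_ereal_sup => z [s' s'B zE].
  have zE' := etrans (esym zE) (covering_numberE_ball s'B).
  have Ps' : P #|img s'| by apply/asboolP; exists s'.
  by rewrite zE' lee_fin ler_nat (leq_trans (maxM _ Ps') (eq_leq (esym sM))).
by apply: ereal_sup_ubound; exists s; [exact: sB | exact: covering_numberE_ball].
Qed.

(** The image is constant on the cosets of p^(b+L) Z_p in the ball, so the sublevel set is a union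
    of [#|G|] of the p^L cosets; [res_image_bound] and [root_bound] then estimate [#|G|]. *)
Lemma sublevel_bound (mu : {measure set padic_borel R p_pr -> \bar R}) (eta : R) s :
  is_haar mu -> 0 < eta < 1 -> padic_ball c rho s ->
  (normalized mu (padic_ball c rho) [set r | padic_ball c rho r /\
     (covering_number alpha delta (poly_eval a r @` E) <
      eta%:E * covering_number alpha delta (poly_eval a s @` E))%E]%classic <=
   (8 * Lam%:R * L%:R * eta `^ (1 / Lam%:R))%:E)%E.
Proof.
move=> mu_haar /andP[eta0 eta1] sB.
have -> : [set r | padic_ball c rho r /\ (covering_number alpha delta (poly_eval a r @` E) <
      eta%:E * covering_number alpha delta (poly_eval a s @` E))%E]%classic =
    [set r | padic_ball c rho r /\ (#|img r|%:R%:E < eta%:E *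
      (#|img s|%:R%:E : \bar R))%E]%classic.
  have -> := covering_numberE_ball sB.
  apply/seteqP; split=> r [rB H]; have rE := covering_numberE_ball rB; split;
    try exact: rB.
    by move: H; rewrite rE.
  by rewrite rE; exact: H.
(* Every point of an ultrametric ball is a centre. *)
have ballE : padic_ball c rho = pball b s.
  have sB' : pdvd b (s - c) by rewrite -bE.
  apply/seteqP; split=> x xB.
    have xB' : pdvd b (x - c) by rewrite -bE.
    by apply: (pdvd_trans nrmP xB'); rewrite (pdvdC nrmP).
  suff : nrm (x - c) <= rho by [].
  by rewrite bE; exact: (pdvd_trans nrmP (xB : pdvd b (x - s)) sB').
have sc_int v (x : D) i : E v -> _ := @shifted_int s v x i sB.
pose G := [set t : 'I_(p ^ L) | #|img (s + u * (t : nat)%:R)|%:R < eta *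
  #|img s|%:R]%SET.
have img_gt0 : (0 < #|img s|)%N.
  have [v Ev] := E0; apply/card_gt0P; exists (val_res p_pr nrm L dD W s v).
  by apply/res_imageP; exists v.
have u0 : u != 0 by rewrite expfz_neq0 // (p_neq0F p_pr nrmP).
have img_near (t : 'I_(p ^ L)) x : pball (b + L) (s + u * (t : nat)%:R) x ->
    img x = img (s + u * (t : nat)%:R).
  move=> xt; pose x' := u^-1 * ((x : Qp) - s).
  have xE : s + u * x' = x := shift_inv (x : Qp) s u0.
  have x't : pdvd L (x' - (t : nat)%:R).
    have : pdvd (b + L) (x - (s + u * (t : nat)%:R)) := xt.
    rewrite (affine_inv (x : Qp) s _ u0) (pdvd_pM p_pr nrmP).
    by rewrite (_ : b + L - b = L) // addrAC subrr add0r.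
  have x'_int : pdvd 0 x'.
    rewrite -(subrK (t : nat)%:R x'); apply: (pdvdD nrmP);
      last exact: (pdvd_nat0 p_pr nrmP).
    exact: (pdvd_le p_pr _ x't).
  rewrite -{1}xE; apply: (res_image_congr p_pr nrmP nrm_res sc_int) => //.
  exact: (pdvd_nat0 p_pr nrmP).
have imgE x : pball b s x -> exists2 t : 'I_(p ^ L),
    pball (b + L) (s + u * (t : nat)%:R) x & img x = img (s + u * (t : nat)%:R).
  rewrite {1}(pball_split R b L s) => -[t _ xt]; exists t;
    [exact: xt | exact: img_near].
rewrite ballE (@normalized_union R p p_pr mu mu_haar b L s G); last first.
  apply/seteqP; split=> x.
    move=> [/imgE[t xt ->]]; rewrite lte_fin => tG; exists t => //.
    by rewrite /= inE.
  move=> [t]; rewrite /= inE => tG xt; split.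
    by rewrite (pball_split R b L s); exists t; rewrite //= inE.
  by rewrite (img_near t x xt) lte_fin.
(* Since eta < 1 and the image at s is nonempty, the integer part [N] stays below its
   cardinality. *)
rewrite lee_fin; pose N := Num.truncn (eta * #|img s|%:R).
have NM : N%:R <= eta * #|img s|%:R by rewrite truncn_le // mulr_ge0 // ltW.
apply: (@root_bound R #|G| (p ^ L) L N #|img s| Lam eta) => //.
- exact: Lam_gt0.
- by rewrite expn_gt0 prime_gt0.
- have := @res_image_bound R p p_pr Qp nrm nrmP nrm_res L D dD _ E W s u sc_int G N.
  rewrite sum_D; apply; first exact: card_D_gt0.
  + by rewrite /L /modexp addn1.
  + move=> t; rewrite inE => /ltW tG; rewrite truncn_ge_nat; first exact: tG.
    by rewrite mulr_ge0 // ltW.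
  + rewrite -(ltr_nat R); apply: le_lt_trans NM _.
    by rewrite -[ltRHS]mul1r ltr_pM2r // ltr0n.
Qed.

End Family.
End Assembly.

(** * The estimate with a constant uniform in the coefficient set *)

Unset Implicit Arguments.
Set Strict Implicit.
Set Printing Implicit Defensive.

Local Open Scope classical_set_scope.
Local Open Scope ring_scope.

Theorem theorem7p2 (R : realType) (p : nat) (p_pr : prime p)
  (k : nat) (k_gt0 : (0 < k)%N) (n d : 'I_k -> nat)
  (n_gt0 : forall i, (0 < n i)%N)
  (alpha : 'I_k -> R) (alpha_ge0 : forall i, 0 <= alpha i)
  (c : padic p_pr) (rho : R) (rho_gt0 : 0 < rho) (bound : R) :
  let B := padic_ball c rho in
  let Lambda : R := (\sum_(i < k) n i * maxn 1 (d i))%N%:R in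
  exists C : R,
  forall mu : {measure set padic_borel R p_pr -> \bar R}, is_haar mu ->
  forall a : scalar_family p_pr d,
  (forall i, a i ord_max != 0) ->
  forall E : set (coef_space p_pr n d), E !=set0 ->
  (forall b, absorbed a E b -> coef_norm R b <= bound) ->
  let N (delta : R) (r : padic p_pr) : \bar R :=
    covering_number alpha delta (poly_eval a r @` E) in
  let M (delta : R) : \bar R := max_covering a alpha delta B E in
  (forall delta : R, 0 < delta < 1 ->
     (exists2 s, B s & N delta s = M delta) /\ (M delta < +oo)%E) /\
  (forall (l : nat) (eta : R), (1 <= l)%N -> 0 < eta < 1 ->
     let delta : R := p%:R ^- l in
     let rhs : R :=
       C * (1 + l%:R) `^ ((Lambda + 1) / Lambda) * eta `^ (1 / Lambda) in
     (normalized mu B [set r | B r /\ N delta r < eta%:E * M delta]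
        <= rhs%:E)%E /\
     (forall r0, B r0 ->
        normalized mu B [set r | B r /\ N delta r < eta%:E * N delta r0]
          <= rhs%:E)%E).
Proof.
move=> B Lambda; have p1 := prime_gt1 p_pr.
(* One exponent controls the coefficient bound, the centre and the radius, so the constant depends
   on nothing else about the family. *)
have [e] := exists_expn_ge (Num.max bound (Num.max (padic_norm R c) rho)) p1.
rewrite !ge_max => /and3P[bound_e c_e rho_e].
have [b bE] := ball_exponent p_pr (padic_normP R p_pr) (@padic_has_residues R p p_pr)
  rho_gt0.
(* [A] is the constant of [modexp_le]; the factor 8 Lambda comes from [root_bound]. *)
pose A : R := (e * (\max_(i < k) d i).+1)%N%:R + k%:R + \sum_i alpha i + 1.
exists (8 * Lambda * A) => mu mu_haar a _ E E0 E_bound N M.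
have NE delta s : 0 < delta < 1 -> B s -> N delta s = _ :=
  fun d01 sB => covering_numberE_ball alpha_ge0 bE bound_e c_e rho_e E_bound d01 sB.
split=> [delta d01|l eta l1 eta01 delta rhs].
  have [s sB sM] := max_covering_attained alpha_ge0 bE bound_e c_e rho_e E_bound d01.
  split; last by rewrite /M sM ltry.
  by exists s => //; rewrite NE // /M sM.
have d01 : 0 < delta < 1.
  exact: inv_expn_itv.
have Lambda_gt0 : 0 < Lambda by rewrite ltr0n Lam_gt0.
have eta_ge0 : 0 <= eta `^ (1 / Lambda) by exact: powR_ge0.
have key s : B s ->
    (normalized mu B [set r | B r /\ N delta r < eta%:E * N delta s] <= rhs%:E)%E.
  move=> sB.
  apply: le_trans (sublevel_bound k_gt0 n_gt0 alpha_ge0 bE bound_e c_e rho_e E0 E_bound d01 mu_haar eta01 sB) _.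
  rewrite lee_fin /rhs; apply: ler_wpM2r => //.
  have L_le := modexp_le p_pr d alpha_ge0 e l1.
  rewrite -/Lambda -[leRHS]mulrA; apply: ler_wpM2l; first by rewrite mulr_ge0 // ltW.
  apply: le_trans L_le _; rewrite -/A.
  have A0 : 0 <= A by rewrite !addr_ge0 ?sumr_ge0.
  (* The linear factor 1 + l is at least 1, so raising it to the exponent 1 + 1/Lambda only
     increases it. *)
  apply: ler_wpM2l => //; have l1' : 1 <= 1 + l%:R :> R by rewrite lerDl.
  rewrite -{1}[1 + l%:R]powRr1; last exact: le_trans l1'.
  by apply: ler_powR => //; rewrite mulrDl divff ?gt_eqF // lerDl divr_ge0 // ltW.
split=> [|r0 r0B]; last exact: key.
(* The maximum is the value at some s in the ball, so its bound is the case r0 = s. *)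
have [s sB sM] := max_covering_attained alpha_ge0 bE bound_e c_e rho_e E_bound d01.
by rewrite /M sM -(NE _ _ d01 sB); exact: key.
Qed.
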